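(* Assume the setting below and suppose every coordinate of the saddle point is critical, i.e. $\zeta_j=1$ for every $j\in\mathcal{A}$. Then \[ \lim_{n\to+\infty}\mathbb{P}(m \text{ is an } \boldsymbol{\alpha}\text{-winner}) = \frac{1}{\sqrt{(2\pi)^{m-1}\det(\mathcal{H}_K(\boldsymbol{\tau}))}}\int_{(0,+\infty)^{m-1}} e^{-\mathbf{u}^T\mathcal{H}_K(\boldsymbol{\tau})^{-1}\mathbf{u}/2}\,d\mathbf{u}. \]
   Context: Fix an integer $m\ge 2$ of candidates $\{1,\dots,m\}$ and let $\mathcal{A}=\{1,\dots,m-1\}$. There are $n$ voters; each voter independently draws a strict ranking $r$ of the candidates with probability $p_r$, where $p_r>0$ for each of the $m!$ rankings and $\sum_r p_r=1$ (independent of $n$). For $\mathcal{X}\subseteq\mathcal{A}$, let $p_{\mathcal{X}}$ be the probability that, in a random ranking, the set of adversaries ranked above $m$ is exactly $\mathcal{X}$; let $P(\mathbf{x})=\sum_{\mathcal{X}\subseteq\mathcal{A}} p_{\mathcal{X}}\prod_{j\in\mathcal{X}}x_j$. Fix $\boldsymbol{\alpha}\in(0,1)^{m-1}$, $\boldsymbol{\beta}=\mathbf{1}-\boldsymbol{\alpha}$. Candidate $m$ is an $\boldsymbol{\alpha}$-winner if for every $j\in\mathcal{A}$, strictly more than $\alpha_j n$ voters rank $m$ above $j$. Let $K(\mathbf{t})=\log P(e^{t_1},\dots,e^{t_{m-1}})$; $\boldsymbol{\tau}$ is the unique maximizer over $\mathbb{R}^{m-1}$ of $-K(\mathbf{t})+\boldsymbol{\beta}^T\mathbf{t}$,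 $\boldsymbol{\zeta}=e^{\boldsymbol{\tau}}$ componentwise, and $\mathcal{H}_K(\boldsymbol{\tau})$ is the Hessian of $K$ at $\boldsymbol{\tau}$. *)

(* Defs.v *)
From HB Require Import structures.
From mathcomp Require Import all_boot all_order all_algebra all_fingroup.
From mathcomp Require Import all_classical all_reals all_analysis.
Set Implicit Arguments. Unset Strict Implicit. Unset Printing Implicit Defensive.
Import Order.TTheory GRing.Theory Num.Theory.
Import numFieldNormedType.Exports.
Local Open Scope classical_set_scope.
Local Open Scope ring_scope.

(* Conventions.  The number of candidates is m = k.+1 (so m >= 2 iff 0 < k).
   Candidates are 'I_k.+1; the distinguished candidate "m" is ord_max, and
   the adversaries A = {1,...,m-1} are the elements [lift ord_max j], j : 'I_k
   (i.e. the indices 0..k-1).  A ranking is a permutation r : {perm 'I_k.+1}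
   where r c is the position of candidate c (0 = top); candidate a is ranked
   above candidate b iff r a < r b. *)

Section Voting.
Variable R : realType.
Variable k : nat.

Definition ranking := {perm 'I_k.+1}.

Definition adv (j : 'I_k) : 'I_k.+1 := lift ord_max j.

Definition above (r : ranking) (a b : 'I_k.+1) : bool := (r a < r b)%N.

Definition advs_above (r : ranking) : {set 'I_k} :=
  [set j | above r (adv j) ord_max].

Definition pX (p : ranking -> R) (X : {set 'I_k}) : R :=
  \sum_(r : ranking | advs_above r == X) p r.

Definition polyP (p : ranking -> R) (x : 'I_k -> R) : R :=
  \sum_(X : {set 'I_k}) pX p X * \prod_(j in X) x j.

Definition cgfK (p : ranking -> R) (t : 'rV[R]_k) : R :=
  ln (polyP p (fun j => expR (t ord0 j))).

Definition hessian (f : 'rV[R]_k -> R) (a : 'rV[R]_k) : 'M[R]_k :=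
  \matrix_(i < k, j < k)
     derive (fun b => derive f b (delta_mx 0 j)) a (delta_mx 0 i).

Definition alpha_winner (n : nat) (alpha : 'I_k -> R)
  (s : {ffun 'I_n -> ranking}) : bool :=
  [forall j : 'I_k,
     alpha j * n%:R < #|[set i : 'I_n | above (s i) ord_max (adv j)]|%:R].

Definition prob_winner (p : ranking -> R) (alpha : 'I_k -> R) (n : nat) : R :=
  \sum_(s : {ffun 'I_n -> ranking} | alpha_winner alpha s)
     \prod_(i : 'I_n) p (s i).

End Voting.

(* Iterated Lebesgue integral over the open orthant (0,+oo)^k of
   f : R^k -> \bar R (integrating the first coordinate outermost;
   the vector (x, v) is built by prepending x to v). *)
Fixpoint orthant_integral (R : realType) (k : nat) :
    ('rV[R]_k -> \bar R) -> \bar R :=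
  match k with
  | 0 => fun f => f 0
  | k'.+1 => fun f =>
      (\int[@lebesgue_measure R]_(x in `]0%R, +oo[)
         orthant_integral (fun v : 'rV[R]_k' =>
           f (\row_(i < k'.+1)
                (if unlift ord0 i is Some j then v ord0 j else (x : R)))))%E
  end.

(* Main.v *)
(** The vector counting, for each adversary, the voters who rank [m] above it,
    minus [alpha n], is a sum of [n] i.i.d. vectors; criticality of the saddle
    point at [tau = 0] makes them centred, with covariance the Hessian [H] of
    the cumulant generating function, and the event is that all coordinates
    are positive.  The central limit theorem is proved in operator form
    (Trotter): averaging a test function over one rescaled step and over the
    Gaussian [N(0, H / n)] differ by [O(n^(-3/2))], both operators contract the
    sup norm, and the Gaussian operators form a semigroup.  The Gaussian vector
    is the Cholesky combination of independent scalar Gaussians, so its density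
    is reached by translations in one variable at a time.  Cubic spline products
    squeeze the indicator of the orthant. *)
Require Import Defs.
From HB Require Import structures.
From mathcomp Require Import all_boot all_order all_algebra all_fingroup.
From mathcomp Require Import all_classical all_reals all_analysis.
From mathcomp Require Import measurable_realfun ring lra.
Set Implicit Arguments. Unset Strict Implicit. Unset Printing Implicit Defensive.
Import Order.TTheory GRing.Theory Num.Theory.
Import numFieldNormedType.Exports.
Local Open Scope classical_set_scope.
Local Open Scope ring_scope.

(** * Scalar Gaussian expectations *)

(** The two operators are treated asymmetrically. In the telescoping sum the one-step comparison is
    applied only to iterates of the averaging operator, a convex combination of translates, which
    keeps every Taylor constant unchanged. The Gaussian side only has to contract and to preserve
    bounded Lipschitz functions, so nothing is ever differentiated under an integral. With [n] steps
    the errors add up to [n * O(n^(-3/2)) = O(n^(-1/2))]. The constants of the test functions blow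
    up as they steepen towards the indicator of the orthant. Hence [n] tends to infinity with the
    steepness [N] fixed, and [N] afterwards. In the second limit only Gaussian averages remain, and
    the test functions converge off the coordinate hyperplanes, which are null in each integration
    variable; so the lower and upper families share one limit. Centring comes from the first-order
    condition at the maximizer 0: adversary [j] is above [m] with probability [1 - alpha j]. *)

Section GaussianExpectation.
Variable R : realType.
Notation mu := (@lebesgue_measure R).
Implicit Types (s t c m r x y z M C : R) (H G : R -> R).

Definition gauss_int s H := mu.-integrable setT (EFin \o (fun z => normal_pdf 0 s z * H z)).
Definition gaussE s H : R := (\int[mu]_z (normal_pdf 0 s z * H z))%R.

Lemma normal_pdf_exp m s z : 0 < s ->
  normal_pdf m s z = normal_peak s * expR (- (z - m) ^+ 2 / (s ^+ 2 *+ 2)).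
Proof. by move=> s0; rewrite normal_pdfE ?gt_eqF. Qed.

Lemma gauss_int_le s H G : measurable_fun setT H -> (forall z, `|H z| <= G z) ->
  gauss_int s G -> gauss_int s H.
Proof.
move=> mH HG iG; apply: (le_integrable _ _ _ iG) => //.
  apply/measurable_EFinP; apply: measurable_funM => //.
  exact: measurable_normal_pdf.
move=> z _ /=; rewrite lee_fin !normrM ler_wpM2l//.
by rewrite (le_trans (HG z))// ler_norm.
Qed.

Lemma gauss_intD s H G : gauss_int s H -> gauss_int s G ->
  gauss_int s (fun z => H z + G z).
Proof.
move=> iH iG; rewrite /gauss_int.
have -> : EFin \o (fun z => normal_pdf 0 s z * (H z + G z)) =
  (EFin \o (fun z => normal_pdf 0 s z * H z)) \+
  (EFin \o (fun z => normal_pdf 0 s z * G z)).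
  by apply/funext => z /=; rewrite mulrDr EFinD.
exact: integrableD.
Qed.

Lemma gauss_intZ s c H : gauss_int s H -> gauss_int s (fun z => c * H z).
Proof.
move=> iH; rewrite /gauss_int.
have -> : EFin \o (fun z => normal_pdf 0 s z * (c * H z)) =
  (fun z => c%:E * (normal_pdf 0 s z * H z)%:E)%E.
  by apply/funext => z /=; rewrite -EFinM mulrCA.
exact: integrableZl.
Qed.

Lemma gauss_int_cst s c : gauss_int s (fun=> c).
Proof.
have -> : (fun=> c) = (fun z : R => c * 1) by apply/funext => z; rewrite mulr1.
apply: gauss_intZ; rewrite /gauss_int.
under eq_fun do rewrite mulr1.
exact: integrable_normal_pdf.
Qed.

Lemma gaussED s H G : gauss_int s H -> gauss_int s G ->
  gaussE s (fun z => H z + G z) = gaussE s H + gaussE s G.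
Proof.
move=> iH iG; rewrite /gaussE -RintegralD//.
by apply: eq_Rintegral => z _; rewrite mulrDr.
Qed.

Lemma gaussEZ s c H : gauss_int s H -> gaussE s (fun z => c * H z) = c * gaussE s H.
Proof.
move=> iH; rewrite /gaussE -RintegralZl//.
by apply: eq_Rintegral => z _; rewrite mulrCA.
Qed.

Lemma gaussE_cst s c : gaussE s (fun=> c) = c.
Proof.
have -> : (fun=> c) = (fun z : R => c * 1) by apply/funext => z; rewrite mulr1.
rewrite gaussEZ; last exact: gauss_int_cst.
rewrite /gaussE /Rintegral.
under eq_integral do rewrite mulr1.
by rewrite integral_normal_pdf mulr1.
Qed.

Lemma gaussE_le s H G : gauss_int s H -> gauss_int s G -> (forall z, H z <= G z) ->
  gaussE s H <= gaussE s G.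
Proof.
move=> iH iG HG; apply: le_Rintegral => // z _.
by rewrite ler_wpM2l// normal_pdf_ge0.
Qed.

Lemma gaussE_norm_le s H G : gauss_int s H -> gauss_int s G ->
  (forall z, `|H z| <= G z) ->
  `|gaussE s H| <= gaussE s G.
Proof.
move=> iH iG HG; rewrite ler_norml; apply/andP; split.
  rewrite -mulN1r -gaussEZ//; apply: gaussE_le => //; first exact: gauss_intZ.
  by move=> z; rewrite mulN1r; have /ler_normlP[+ _] := HG z; rewrite lerNl.
by apply: gaussE_le => // z; rewrite (le_trans (ler_norm _)).
Qed.

(** Doubling the scale divides the exponent [y = z ^ 2 / (2 * s ^ 2)] by 4, which frees a factor
    [expR (3 / 4 * y)]. This factor is at least [(1 + 3 / 8 * y) ^ 2], of degree 4 in [z], and so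
    beats the cube. The 64 is 32 from that comparison times 2 from the ratio of the peaks. *)
Lemma pdf_cube_le s z : 0 < s ->
  normal_pdf 0 s z * `|z| ^+ 3 <= 64 * s ^+ 3 * normal_pdf 0 (2 * s) z.
Proof.
move=> s0; rewrite !normal_pdf_exp ?mulr_gt0// subr0.
have -> : @normal_peak R s = 2 * normal_peak (2 * s).
  rewrite /normal_peak.
  have -> : (2 * s) ^+ 2 * pi *+ 2 = 2 ^+ 2 * (s ^+ 2 * pi *+ 2) :> R by ring.
  rewrite sqrtrM ?sqr_ge0// sqrtr_sqr ger0_norm// invfM mulrA mulfV ?mul1r//.
set y := z ^+ 2 / (s ^+ 2 *+ 2).
have y0 : 0 <= y by rewrite divr_ge0 ?sqr_ge0// mulrn_wge0// sqr_ge0.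
have -> : - z ^+ 2 / (s ^+ 2 *+ 2) = - y by rewrite mulNr.
have s_neq0 : s != 0 by rewrite gt_eqF.
have -> : - z ^+ 2 / ((2 * s) ^+ 2 *+ 2) = 3 / 4 * y - y.
  by rewrite /y; field.
rewrite expRD.
set e := expR (- y).
have e0 : 0 <= e by exact: expR_ge0.
have p0 := normal_peak_ge0 (2 * s).
have e3 : `|z| ^+ 3 <= 32 * s ^+ 3 * expR (3 / 4 * y).
  have h1 : (1 + 3 / 8 * y) ^+ 2 <= expR (3 / 4 * y).
    have -> : 3 / 4 * y = 2%:R * (3 / 8 * y) by field.
    rewrite expRM_natl lerXn2r ?nnegrE ?expR_ge0//; first by lra.
    exact: expR_ge1Dx.
  pose t := `|z| / s.
  have t0 : 0 <= t by rewrite divr_ge0// ltW.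
  have zE : `|z| = t * s by rewrite /t divfK.
  have yE : y = t ^+ 2 / 2.
    by rewrite /y -(real_normK (num_real z)) zE; field.
  rewrite zE exprMn [leRHS]mulrAC.
  rewrite ler_wpM2r ?exprn_ge0 ?(ltW s0)//.
  apply: (@le_trans _ _ (32 * (1 + 3 / 8 * y) ^+ 2)); last by lra.
  rewrite yE; nra.
have -> : 2 * normal_peak (2 * s) * e * `|z| ^+ 3 =
  2 * normal_peak (2 * s) * e * `|z| ^+ 3 by [].
have : 0 <= 2 * normal_peak (2 * s) * e by rewrite !mulr_ge0.
move=> /ler_wpM2l /(_ _ _ e3); lra.
Qed.


Lemma gauss_int_cube s : 0 < s -> gauss_int s (fun z => `|z| ^+ 3).
Proof.
move=> s0.
have ig : mu.-integrable setT
    (fun z => (64 * s ^+ 3)%:E * (normal_pdf 0 (2 * s) z)%:E)%E.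
  by apply: integrableZl => //; exact: integrable_normal_pdf.
apply: (le_integrable _ _ _ ig) => //.
  apply/measurable_EFinP; apply: measurable_funM => //.
    exact: measurable_normal_pdf.
  by apply: measurable_funX; exact: normr_measurable.
move=> z _ /=; rewrite lee_fin ger0_norm; last first.
  by rewrite mulr_ge0 ?normal_pdf_ge0 ?exprn_ge0.
by rewrite (le_trans (pdf_cube_le z s0))// ler_norm.
Qed.

Lemma gaussE_cube s : 0 < s -> gaussE s (fun z => `|z| ^+ 3) <= 64 * s ^+ 3.
Proof.
move=> s0.
have <- : (\int[mu]_z (64 * s ^+ 3 * normal_pdf 0 (2 * s) z) = 64 * s ^+ 3)%R.
  rewrite RintegralZl//; last exact: integrable_normal_pdf.
  by rewrite /Rintegral integral_normal_pdf mulr1.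
apply: le_Rintegral => //; first exact: gauss_int_cube.
  have -> : EFin \o (fun z => 64 * s ^+ 3 * normal_pdf 0 (2 * s) z) =
    (fun z => (64 * s ^+ 3)%:E * (normal_pdf 0 (2 * s) z)%:E)%E by [].
  by apply: integrableZl => //; exact: integrable_normal_pdf.
by move=> z _; exact: pdf_cube_le.
Qed.

Lemma gauss_int_growth s H M : 0 < s -> measurable_fun setT H ->
  (forall z, `|H z| <= M * (1 + `|z| ^+ 3)) -> gauss_int s H.
Proof.
move=> s0 mH HM; apply: (gauss_int_le mH HM).
by apply: gauss_intZ; apply: gauss_intD; [exact: gauss_int_cst|exact: gauss_int_cube].
Qed.

Lemma gauss_int_bounded s H M : measurable_fun setT H ->
  (forall z, `|H z| <= M) -> gauss_int s H.
Proof. by move=> mH HM; apply: (gauss_int_le mH HM); exact: gauss_int_cst. Qed.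

Lemma gauss_int_id s : 0 < s -> gauss_int s id.
Proof.
move=> s0; apply: (@gauss_int_growth _ _ 1) => // z.
rewrite mul1r; set a := `|z|; have a0 : 0 <= a by exact: normr_ge0.
have [a1|a1] := leP a 1; first by rewrite (le_trans a1)// lerDl exprn_ge0.
have : a <= a ^+ 3 by rewrite -[leLHS]expr1 ler_weXn2l// ltW.
by move=> h; rewrite (le_trans h)// lerDr.
Qed.

Lemma gauss_int_norm s H : measurable_fun setT H -> gauss_int s H ->
  gauss_int s (fun z => `|H z|).
Proof.
move=> mH iH; apply: (le_integrable _ _ _ iH) => //.
  apply/measurable_EFinP; apply: measurable_funM => //.
    exact: measurable_normal_pdf.
  exact: measurableT_comp.
by move=> z _ /=; rewrite lee_fin !normrM normr_id.
Qed.

Lemma gauss_int_sqr s : 0 < s -> gauss_int s (fun z => z ^+ 2).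
Proof.
move=> s0; apply: (@gauss_int_growth _ _ 1) => //.
move=> z; rewrite mul1r normrX; set a := `|z|; have a0 : 0 <= a by exact: normr_ge0.
have [a1|a1] := leP a 1.
  by rewrite (le_trans (exprn_ile1 _ _ a1))// lerDl exprn_ge0.
have : a ^+ 2 <= a ^+ 3 by rewrite ler_weXn2l// ltW.
by move=> h; rewrite (le_trans h)// lerDr.
Qed.

(* Minorizing the tilted density by its tangent at the untilted one gives
   2 m E z <= m ^ 2 for every m. *)
Lemma gaussE_id s : 0 < s -> gaussE s id = 0.
Proof.
move=> s0; have s_neq0 : s != 0 by rewrite gt_eqF.
set e := gaussE s id.
have ie := gauss_int_id s0.
(* The tilt is taken to be [m = e] itself, which turns the bound into [2 * e ^ 2 <= e ^ 2]. *)
pose u := 2 * e / (s ^+ 2 *+ 2); pose v := - e ^+ 2 / (s ^+ 2 *+ 2).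
have h : 1 + (u * e + v) <= 1.
  have i1 : gauss_int s (fun z => u * z + v).
    by apply: gauss_intD; [exact: gauss_intZ|exact: gauss_int_cst].
  have -> : 1 + (u * e + v) = gaussE s (fun z => 1 + (u * z + v)).
    rewrite gaussED//; last exact: gauss_int_cst.
    by rewrite gaussED; [|exact: gauss_intZ|exact: gauss_int_cst]; rewrite gaussEZ// !gaussE_cst.
  apply: (@le_trans _ _ (\int[mu]_z normal_pdf e s z)%R); last first.
    by rewrite /Rintegral integral_normal_pdf.
  apply: le_Rintegral => //.
  - by apply: gauss_intD => //; exact: gauss_int_cst.
  - exact: integrable_normal_pdf.
  - move=> z _; rewrite !normal_pdf_exp// -mulrA ler_wpM2l ?normal_peak_ge0//.
    have -> : - (z - e) ^+ 2 / (s ^+ 2 *+ 2) = - (z - 0) ^+ 2 / (s ^+ 2 *+ 2) +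
       (u * z + v) by rewrite /u /v; field.
    by rewrite expRD ler_wpM2l ?expR_ge0//; exact: expR_ge1Dx.
have : e ^+ 2 / (s ^+ 2 *+ 2) <= 0.
  rewrite gerDl in h; apply: le_trans h; rewrite /u /v.
  by rewrite le_eqVlt; apply/orP; left; apply/eqP; field.
rewrite pmulr_lle0; last by rewrite invr_gt0 mulrn_wgt0// exprn_gt0.
by move=> e2; apply/eqP; rewrite -sqrf_eq0 eq_le e2 sqr_ge0.
Qed.

Lemma normal_peakE s : 0 < s -> normal_peak s = s^-1 * (Num.sqrt (pi *+ 2))^-1 :> R.
Proof.
move=> s0; rewrite /normal_peak -mulrnAr sqrtrM ?sqr_ge0// sqrtr_sqr.
by rewrite gtr0_norm// invfM.
Qed.

(* The analogous tangent bound for a change of scale by [r]; [r -> 1] from both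
   sides then gives the second moment. *)
Lemma gaussE_sqr_tangent s r : 0 < s -> 0 < r ->
  1 + (1 - r ^- 2) / 2 * (gaussE s (fun z => z ^+ 2) / s ^+ 2) <= r.
Proof.
move=> s0 r0; have s_neq0 : s != 0 by rewrite gt_eqF.
have r_neq0 : r != 0 by rewrite gt_eqF.
have is2 := gauss_int_sqr s0.
pose u := (1 - r ^- 2) / 2 / s ^+ 2.
have -> : 1 + (1 - r ^- 2) / 2 * (gaussE s (fun z => z ^+ 2) / s ^+ 2) =
    gaussE s (fun z => 1 + u * z ^+ 2).
  rewrite gaussED; [|exact: gauss_int_cst|exact: gauss_intZ].
  by rewrite gaussE_cst gaussEZ// /u mulrA mulrAC.
apply: (@le_trans _ _ (\int[mu]_z (r * normal_pdf 0 (s * r) z))%R); last first.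
  rewrite RintegralZl//; last exact: integrable_normal_pdf.
  by rewrite /Rintegral integral_normal_pdf mulr1.
apply: le_Rintegral => //.
- by apply: gauss_intD; [exact: gauss_int_cst|exact: gauss_intZ].
- have -> : EFin \o (fun z => r * normal_pdf 0 (s * r) z) =
    (fun z => r%:E * (normal_pdf 0 (s * r) z)%:E)%E by [].
  by apply: integrableZl => //; exact: integrable_normal_pdf.
- move=> z _; rewrite !normal_pdf_exp ?mulr_gt0// !subr0.
  rewrite !normal_peakE ?mulr_gt0// invfM !mulrA.
  have -> : r / s / r = s^-1 by rewrite mulrAC mulfV// mul1r.
  rewrite -[leLHS]mulrA ler_wpM2l//.
    by rewrite mulr_ge0// ?invr_ge0 ?sqrtr_ge0 ?ltW.
  have -> : - z ^+ 2 / ((s * r) ^+ 2 *+ 2) = - z ^+ 2 / (s ^+ 2 *+ 2) +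
    u * z ^+ 2 by rewrite /u; field; rewrite s_neq0.
  by rewrite expRD ler_wpM2l ?expR_ge0// -mulrA; exact: expR_ge1Dx.
Qed.

Lemma gaussE_sqr s : 0 < s -> gaussE s (fun z => z ^+ 2) = s ^+ 2.
Proof.
move=> s0; have s_neq0 : s != 0 by rewrite gt_eqF.
have tg r : 0 < r -> _ := @gaussE_sqr_tangent s r s0.
set q := _ / s ^+ 2 in tg.
suff q1 : q = 1.
  by rewrite -[RHS]mul1r -q1 /q divfK// expf_neq0.
have q0 : 0 <= q.
  rewrite divr_ge0 ?sqr_ge0// /gaussE Rintegral_ge0// => z _.
  by rewrite mulr_ge0 ?normal_pdf_ge0 ?sqr_ge0.
have tg' r : 0 < r -> (r ^+ 2 - 1) * q <= 2 * r ^+ 2 * (r - 1).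
  move=> r0; have := tg r r0; have r_neq0 : r != 0 by rewrite gt_eqF.
  rewrite -lerBrDl.
  have -> : (1 - r ^- 2) / 2 * q = (r ^+ 2 - 1) * q / (2 * r ^+ 2) by field.
  by rewrite ler_pdivrMr ?mulr_gt0 ?exprn_gt0// [(r - 1) * _]mulrC.
apply/eqP; rewrite eq_le; apply/andP; split; rewrite leNgt; apply/negP => qq.
(* Dividing by [e] leaves [(2 + e) * q <= 2 * (1 + e) ^ 2], which tends to [q <= 1] as [e] tends to
   0. The cap at 1 and the 5 make [e] small enough to contradict [1 < q]. In the other case
   [r = 1 - e] reverses the inequality. *)
- pose e := Num.min 1 ((q - 1) / 5).
  have e0 : 0 < e by rewrite lt_min ltr01/= divr_gt0// subr_gt0.
  have e1 : e <= 1 by rewrite ge_min lexx.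
  have eq5 : e <= (q - 1) / 5 by rewrite ge_min lexx orbT.
  have := tg' (1 + e); rewrite addr_gt0// => /(_ isT).
  have -> : (1 + e) ^+ 2 - 1 = e * (2 + e) by ring.
  have -> : 2 * (1 + e) ^+ 2 * (1 + e - 1) = e * (2 * (1 + e) ^+ 2) by ring.
  rewrite -mulrA ler_pM2l//; nra.
- pose e := (1 - q) / 5.
  have e0 : 0 < e by rewrite divr_gt0// subr_gt0.
  have e1 : e <= 1/5 by rewrite /e; lra.
  have qE : q = 1 - 5 * e by rewrite /e; field.
  have := tg' (1 - e); rewrite subr_gt0 (le_lt_trans e1) ?ltr_pdivrMr ?mul1r ?ltr1n// => /(_ isT).
  have -> : (1 - e) ^+ 2 - 1 = - e * (2 - e) by ring.
  have -> : 2 * (1 - e) ^+ 2 * (1 - e - 1) = - e * (2 * (1 - e) ^+ 2) by ring.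
  rewrite -mulrA !mulNr lerN2 ler_pM2l//; rewrite qE; nra.
Qed.

(** By AM-GM, [|z| <= s / 2 + z ^ 2 / (2 * s)], and the right side has expectation exactly [s]. *)
Lemma gaussE_norm_id s : 0 < s -> gaussE s (fun z => `|z|) <= s.
Proof.
move=> s0; have s_neq0 : s != 0 by rewrite gt_eqF.
have is2 := gauss_int_sqr s0.
have {2}-> : s = gaussE s (fun z => s / 2 + (2 * s)^-1 * z ^+ 2).
  rewrite gaussED; [|exact: gauss_int_cst|exact: gauss_intZ].
  by rewrite gaussE_cst gaussEZ// gaussE_sqr//; field.
apply: gaussE_le.
- by apply: gauss_int_norm => //; exact: gauss_int_id.
- by apply: gauss_intD; [exact: gauss_int_cst|exact: gauss_intZ].
- move=> z; rewrite -(real_normK (num_real z)); set a := `|z|.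
  rewrite -subr_ge0.
  have -> : s / 2 + (2 * s)^-1 * a ^+ 2 - a = (a - s) ^+ 2 / (2 * s) by field.
  by rewrite divr_ge0 ?sqr_ge0// mulr_ge0// ltW.
Qed.


(** * Convolution and exchange of scalar Gaussian averages *)

Lemma integral_shift (G : R -> R) c : continuous G -> (forall x, 0 <= G x) ->
  (\int[mu]_x (G x)%:E = \int[mu]_x (G (x + c))%:E)%E.
Proof.
move=> cG G0.
have dF (x : R) : is_derive x (1 : R) (fun x : R => x + c) 1.
  by rewrite -[X in is_derive _ _ _ X]addr0; apply: is_deriveD.
have F'E : derive1 (fun x : R => x + c) = cst 1.
  by apply/funext => x; rewrite derive1E; apply: derive_val.
rewrite (@increasing_ge0_integration_by_substitutionT _ (fun x => x + c) G)//.
- by apply: eq_integral => x _; rewrite F'E !fctE mulr1.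
- by move=> x y xy; rewrite ltrD2r.
- by rewrite F'E => ?; exact: cvg_cst.
- by rewrite F'E; exact: is_cvg_cst.
- by rewrite F'E; exact: is_cvg_cst.
- exact: cvg_addrr_Ny.
- exact: cvg_addrr.
Qed.

(** Completing the square in [y]: for independent Gaussians of scales [s] and [t], the joint density
    of the first one and the sum is the density of the sum times the conditional density of the
    first given that the sum is [z]. *)
Lemma normal_pdf_convol s t y z : 0 < s -> 0 < t ->
  let r := Num.sqrt (s ^+ 2 + t ^+ 2) in
  normal_pdf 0 s y * normal_pdf 0 t (z - y) =
  normal_pdf 0 r z * normal_pdf (z * s ^+ 2 / r ^+ 2) (s * t / r) y.
Proof.
move=> s0 t0 r.
have r0 : 0 < r by rewrite sqrtr_gt0 addr_gt0// exprn_gt0.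
have rE : r ^+ 2 = s ^+ 2 + t ^+ 2 by rewrite sqr_sqrtr// addr_ge0 ?sqr_ge0.
have s_neq0 : s != 0 by rewrite gt_eqF.
have t_neq0 : t != 0 by rewrite gt_eqF.
have r_neq0 : r != 0 by rewrite gt_eqF.
rewrite !normal_pdf_exp ?divr_gt0 ?mulr_gt0// !normal_peakE ?divr_gt0 ?mulr_gt0//.
rewrite mulrACA -expRD [RHS]mulrACA -expRD; congr (_ * expR _).
  have : Num.sqrt (pi *+ 2) != 0 :> R.
    by rewrite gt_eqF// sqrtr_gt0 mulrn_wgt0// pi_gt0.
  by move: (Num.sqrt _) => q q_neq0; field; rewrite ?s_neq0 ?t_neq0 ?r_neq0 ?q_neq0.
rewrite exprMn exprVn exprMn rE; field.
by rewrite s_neq0 t_neq0 -rE expf_neq0.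
Qed.

(** Lipschitz functions are measurable and remain Lipschitz after averaging over a parameter, so
    this class supplies measurability at every level of an iterated Gaussian average. *)
Definition lipschitz1 C H := forall x y : R, `|H x - H y| <= C * `|x - y|.

Lemma lipschitz1_continuous C H : lipschitz1 C H -> continuous H.
Proof.
move=> HC x; apply/cvgrPdist_le => /= e e0.
have C0 : 0 < Num.max C 1 by rewrite lt_max ltr01 orbT.
near=> y; rewrite (le_trans (HC x y))//.
apply: (@le_trans _ _ (Num.max C 1 * `|x - y|)).
  by rewrite ler_wpM2r// le_max lexx.
rewrite mulrC -ler_pdivlMr//.
near: y; apply: cvgr_dist_le; [exact: cvg_id|by rewrite divr_gt0].
Unshelve. all: by end_near. Qed.

Lemma lipschitz1_measurable C H : lipschitz1 C H -> measurable_fun setT H.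
Proof. by move=> /lipschitz1_continuous /continuous_measurable_fun. Qed.

Lemma gaussE_norm_bound s H M : measurable_fun setT H ->
  (forall z, `|H z| <= M) -> `|gaussE s H| <= M.
Proof.
move=> mH HM; rewrite -(gaussE_cst s M); apply: gaussE_norm_le => //.
  exact: gauss_int_bounded HM.
exact: gauss_int_cst.
Qed.

Lemma gaussEB s H G : gauss_int s H -> gauss_int s G ->
  gaussE s (fun z => H z - G z) = gaussE s H - gaussE s G.
Proof.
move=> iH iG; rewrite -mulN1r -gaussEZ// -gaussED//; last exact: gauss_intZ.
by congr gaussE; apply/funext => z; rewrite mulN1r.
Qed.

Lemma gaussE_lipschitz1 s (F : R -> R -> R) M C :
  (forall y, measurable_fun setT (F y)) -> (forall y z, `|F y z| <= M) ->
  (forall z, lipschitz1 C (F ^~ z)) -> lipschitz1 C (fun y => gaussE s (F y)).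
Proof.
move=> mF FM FC y y'.
have iF u : gauss_int s (F u) by apply: gauss_int_bounded (FM u).
rewrite -gaussEB//; apply: gaussE_norm_bound; first exact: measurable_funB.
by move=> z; exact: FC.
Qed.

(** After translating the inner variable, Tonelli applies because [H] is nonnegative. Integrating
    first over [y], the conditional density of [normal_pdf_convol] has mass 1 and leaves the density
    of the sum. *)
Lemma gaussE_conv_ge0 s t H M C : 0 < s -> 0 < t -> lipschitz1 C H ->
  (forall x, 0 <= H x <= M) ->
  gaussE s (fun y => gaussE t (fun z => H (y + z))) = gaussE (Num.sqrt (s ^+ 2 + t ^+ 2)) H.
Proof.
move=> s0 t0 HC HM; set r := Num.sqrt _.
have cH := lipschitz1_continuous HC.
have mH := lipschitz1_measurable HC.
have H0 x : 0 <= H x by have /andP[] := HM x.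
have Hb x : `|H x| <= M by rewrite ger0_norm//; have /andP[] := HM x.
have gEe u G : gauss_int u G -> (forall x, 0 <= G x) ->
    ((gaussE u G)%:E = \int[mu]_z (normal_pdf 0 u z * G z)%:E)%E.
  move=> iG G0; rewrite /gaussE /Rintegral fineK//.
  exact: integrable_fin_num.
apply: EFin_inj.
have in_t y : gauss_int t (fun z => H (y + z)).
  apply: (@gauss_int_bounded _ _ M) => //.
  by apply: measurableT_comp => //; exact: measurable_funD.
have innerE y : ((gaussE t (fun z => H (y + z)))%:E =
    \int[mu]_z (normal_pdf 0 t (z - y) * H z)%:E)%E.
  rewrite gEe//; rewrite [RHS](integral_shift y).
  - by apply: eq_integral => z _; rewrite addrK addrC.
  - move=> z; apply: cvgM; last exact: cH.
    apply: (@continuous_comp _ _ _ (fun z => z - y) (normal_pdf 0 t)).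
      by apply: (@cvgB _ R^o); [exact: cvg_id|exact: cvg_cst].
    by apply: continuous_normal_pdf; rewrite gt_eqF.
  - by move=> z; rewrite mulr_ge0 ?normal_pdf_ge0.
pose F (p : R * R) : \bar R :=
  (normal_pdf 0 s p.1 * (normal_pdf 0 t (p.2 - p.1) * H p.2))%:E.
have mF : measurable_fun setT F.
  apply/measurable_EFinP; apply: measurable_funM.
    by apply: measurableT_comp => //; exact: measurable_normal_pdf.
  apply: measurable_funM; last exact: measurableT_comp.
  apply: measurableT_comp; first exact: measurable_normal_pdf.
  exact: measurable_funB.
have F0 p : (0 <= F p)%E by rewrite lee_fin !mulr_ge0 ?normal_pdf_ge0.
transitivity (\int[mu]_y \int[mu]_z F (y, z))%E.
  rewrite gEe.
  - apply: eq_integral => y _; rewrite EFinM innerE -ge0_integralZl//.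
    + apply/measurable_EFinP; apply: measurable_funM => //.
      apply: measurableT_comp; first exact: measurable_normal_pdf.
      exact: measurable_funB.
    + by move=> z _; rewrite lee_fin mulr_ge0 ?normal_pdf_ge0.
    + by rewrite lee_fin normal_pdf_ge0.
  - apply: (@gauss_int_bounded _ _ M).
      apply: (@lipschitz1_measurable C); apply: (@gaussE_lipschitz1 t _ M) => //.
        by move=> y; apply: measurableT_comp => //; exact: measurable_funD.
      move=> z x y; rewrite (le_trans (HC _ _))//.
      by rewrite (_ : x + z - (y + z) = x - y)//; ring.
    move=> y; rewrite -(gaussE_cst t M); apply: gaussE_norm_le => //; exact: gauss_int_cst.
  - by move=> y; rewrite Rintegral_ge0// => z _; rewrite mulr_ge0 ?normal_pdf_ge0.
transitivity (\int[mu]_z \int[mu]_y F (y, z))%E.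
  exact: (@fubini_tonelli _ _ _ _ R mu mu F mF F0).
rewrite gEe//; last exact: gauss_int_bounded Hb.
apply: eq_integral => z _.
transitivity (\int[mu]_y ((normal_pdf 0 r z * H z)%:E *
   (normal_pdf (z * s ^+ 2 / r ^+ 2) (s * t / r) y)%:E))%E.
  apply: eq_integral => y _; rewrite /F/= -EFinM; congr EFin.
  by rewrite mulrA normal_pdf_convol// mulrAC.
rewrite ge0_integralZl//.
- by rewrite integral_normal_pdf mule1.
- by apply/measurable_EFinP; exact: measurable_normal_pdf.
- by move=> y _; rewrite lee_fin normal_pdf_ge0.
- by rewrite lee_fin mulr_ge0 ?normal_pdf_ge0.
Qed.


Lemma gaussE_conv s t H M C : 0 < s -> 0 < t -> lipschitz1 C H ->
  (forall x, `|H x| <= M) ->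
  gaussE s (fun y => gaussE t (fun z => H (y + z))) = gaussE (Num.sqrt (s ^+ 2 + t ^+ 2)) H.
Proof.
move=> s0 t0 HC HM; have mH := lipschitz1_measurable HC.
have mHy y : measurable_fun setT (fun z => H (y + z)).
  by apply: measurableT_comp => //; exact: measurable_funD.
have iHy y u : gauss_int u (fun z => H (y + z)) by apply: (gauss_int_bounded _ (M := M)).
have iH u : gauss_int u H by apply: gauss_int_bounded HM.
have iK : gauss_int s (fun y => gaussE t (fun z => H (y + z))).
  apply: (gauss_int_bounded _ (M := M)); last by move=> y; exact: gaussE_norm_bound.
  apply: (@lipschitz1_measurable C); apply: (@gaussE_lipschitz1 t _ M) => //.
  move=> z x y; rewrite (le_trans (HC _ _))//.
  by rewrite (_ : x + z - (y + z) = x - y)//; ring.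
(* Adding [M] makes the integrand nonnegative and adds the same constant to both sides. *)
have := @gaussE_conv_ge0 s t (fun x => H x + M) (M + M) C s0 t0.
have -> : (fun y => gaussE t (fun z => H (y + z) + M)) =
   (fun y => gaussE t (fun z => H (y + z)) + M).
  by apply/funext => y; rewrite gaussED ?gaussE_cst//; exact: gauss_int_cst.
rewrite !gaussED//; [|exact: gauss_int_cst|exact: gauss_int_cst].
rewrite !gaussE_cst => h; apply: (addIr M); apply: h.
- by move=> x y; rewrite (_ : _ - _ = H x - H y) ?HC//; ring.
- by move=> x; have := HM x; rewrite ler_norml => /andP[]; lra.
Qed.

(* [F y z] is the supremum over rational [q] of [F q z - C * |y - q|]. *)
Lemma measurable_lipschitz1_uncurry (F : R -> R -> R) M C :
  (forall y, measurable_fun setT (F y)) -> (forall y z, `|F y z| <= M) ->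
  0 <= C -> (forall z, lipschitz1 C (F ^~ z)) ->
  measurable_fun setT (fun p : R * R => F p.1 p.2).
Proof.
move=> mF FM C0 FC.
(* [q] runs through all rationals; a code that denotes none defaults to 0. *)
pose q n : R := ratr (odflt 0 (unpickle n : option rat)).
pose h n (p : R * R) := F (q n) p.2 - C * `|p.1 - q n|.
have h_le n p : h n p <= F p.1 p.2.
  rewrite /h lerBlDr -lerBlDl distrC.
  by rewrite (le_trans (ler_norm _))//; exact: FC.
have hub p : has_ubound (range (h ^~ p)).
  by exists (F p.1 p.2) => _ [n _ <-]; exact: h_le.
have -> : (fun p : R * R => F p.1 p.2) = (fun p => sups (h ^~ p) 0).
  apply/funext => p; apply/eqP; rewrite eq_le; apply/andP; split; last first.
    apply: ge_sup; first by exists (h 0%N p), 0%N.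
    by move=> _ [n _ <-]; exact: h_le.
  apply/ler_addgt0Pr => e e0.
  (* An error [C * d] is paid twice, once by the Lipschitz bound and once by the penalty term of
     [h]; the [+ 1] covers [C = 0]. *)
  pose d := e / (2 * (C + 1)).
  have d0 : 0 < d by rewrite divr_gt0// mulr_gt0// ltr_wpDl.
  have [r] := @rat_in_itvoo R p.1 (p.1 + d) ltac:(by rewrite ltrDl).
  rewrite in_itv/= => /andP[r1 r2].
  have qr : q (pickle r) = ratr r by rewrite /q pickleK.
  have pr : `|p.1 - ratr r| <= d.
    by rewrite ler_norml; apply/andP; split; lra.
  apply: (@le_trans _ _ (h (pickle r) p + e)); last first.
    rewrite lerD2r; apply: ub_le_sup; last by exists (pickle r).
    by case: (hub p) => u hu; exists u => _ [n _ <-]; apply: hu; exists n.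
  have := FC p.2 p.1 (ratr r); rewrite ler_norml => /andP[_ h1].
  rewrite /h qr.
  have : C * `|p.1 - ratr r| <= C * d by rewrite ler_wpM2l.
  have : 2 * (C * d) <= e.
    rewrite /d mulrA mulrA ler_pdivrMr ?mulr_gt0 ?ltr_wpDl//.
    nra.
  lra.
apply: measurable_fun_sups => // n; rewrite /h.
apply: measurable_funB; first exact: measurableT_comp.
apply: measurable_funM => //; apply: measurableT_comp => //.
exact: measurable_funB.
Qed.

(** Fubini needs joint measurability, which separate Lipschitz continuity provides, and
    integrability, which holds because the product density times [M] dominates. *)
Lemma gaussE_swap s t (F : R -> R -> R) M C : 0 < s -> 0 < t ->
  (forall y z, `|F y z| <= M) -> 0 <= C ->
  (forall z, lipschitz1 C (F ^~ z)) -> (forall y, lipschitz1 C (F y)) ->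
  gaussE s (fun y => gaussE t (F y)) = gaussE t (fun z => gaussE s (F ^~ z)).
Proof.
move=> s0 t0 FM C0 FC1 FC2.
have mF y : measurable_fun setT (F y) by exact: lipschitz1_measurable (FC2 y).
have mF' z : measurable_fun setT (F ^~ z) by exact: lipschitz1_measurable (FC1 z).
have mF2 := measurable_lipschitz1_uncurry mF FM C0 FC1.
pose G (p : R * R) : \bar R :=
  (normal_pdf 0 s p.1 * normal_pdf 0 t p.2 * F p.1 p.2)%:E.
have mG : measurable_fun setT G.
  apply/measurable_EFinP; apply: measurable_funM => //.
  by apply: measurable_funM; apply: measurableT_comp => //; exact: measurable_normal_pdf.
have gEe u H : gauss_int u H ->
    ((gaussE u H)%:E = \int[mu]_z (normal_pdf 0 u z * H z)%:E)%E.
  by move=> iH; rewrite /gaussE /Rintegral fineK//; exact: integrable_fin_num.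
have iF y : gauss_int t (F y) by apply: gauss_int_bounded (FM y).
have iF' z : gauss_int s (F ^~ z) by apply: (gauss_int_bounded _ (M := M)).
have iG : (mu \x mu)%E.-integrable setT G.
  apply/integrable12ltyP => //.
  apply: (@le_lt_trans _ _ (\int[mu]_y \int[mu]_z
      ((normal_pdf 0 s y * normal_pdf 0 t z * M)%:E))%E); last first.
    under eq_integral => y _.
      rewrite (_ : (\int[mu]_z _ = (normal_pdf 0 s y * M)%:E)%E); first over.
      under eq_integral => z _ do rewrite mulrAC EFinM.
      rewrite integralZl//; last exact: integrable_normal_pdf.
      by rewrite integral_normal_pdf mule1.
    under eq_integral => y _ do rewrite mulrC EFinM.
    rewrite integralZl//; last exact: integrable_normal_pdf.
    by rewrite integral_normal_pdf mule1 ltry.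
  have M0 : 0 <= M by rewrite (le_trans _ (FM 0 0)).
  have pos y z : 0 <= normal_pdf 0 s y * normal_pdf 0 t z * M.
    by rewrite !mulr_ge0 ?normal_pdf_ge0.
  have mP : measurable_fun setT (fun p : R * R =>
      (normal_pdf 0 s p.1 * normal_pdf 0 t p.2 * M)%:E).
    apply/measurable_EFinP; apply: measurable_funM => //.
    by apply: measurable_funM; apply: measurableT_comp => //; exact: measurable_normal_pdf.
  have mA : measurable_fun setT (abse \o G) by exact: measurableT_comp.
  apply: ge0_le_integral => //.
  - by move=> y _; apply: integral_ge0.
  - exact: (@measurable_fun_fubini_tonelli_F _ _ _ _ R mu (abse \o G) mA (fun p => abse_ge0 (G p))).
  - apply: (@measurable_fun_fubini_tonelli_F _ _ _ _ R mu (fun p : R * R =>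
      (normal_pdf 0 s p.1 * normal_pdf 0 t p.2 * M)%:E) mP) => p.
    by rewrite lee_fin.
  - move=> y _; apply: ge0_le_integral => //.
    + exact: (measurableT_comp mA (measurable_pair1 _)).
    + exact: (measurableT_comp mP (measurable_pair1 _)).
    + move=> z _; rewrite /G lee_fin/= normrM ger0_norm ?mulr_ge0 ?normal_pdf_ge0//.
      by rewrite ler_wpM2l// mulr_ge0 ?normal_pdf_ge0.
have mi1 : gauss_int s (fun y => gaussE t (F y)).
  apply: (gauss_int_bounded _ (M := M)); last by move=> y; exact: gaussE_norm_bound.
  apply: (@lipschitz1_measurable C); exact: (@gaussE_lipschitz1 t _ M).
have mi2 : gauss_int t (fun z => gaussE s (F ^~ z)).
  apply: (gauss_int_bounded _ (M := M)); last by move=> z; exact: gaussE_norm_bound.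
  by apply: (@lipschitz1_measurable C); apply: (@gaussE_lipschitz1 s (fun z y => F y z) M).
apply: EFin_inj; rewrite (gEe _ _ mi1) (gEe _ _ mi2).
transitivity (\int[mu]_y \int[mu]_z G (y, z))%E.
  apply: eq_integral => y _; rewrite EFinM gEe// -integralZl//; last exact: iF.
  by apply: eq_integral => z _; rewrite -EFinM mulrA.
rewrite Fubini//.
apply: eq_integral => z _; rewrite EFinM gEe// -integralZl//; last exact: iF'.
by apply: eq_integral => y _; rewrite /G/= -EFinM mulrA [normal_pdf 0 t z * _]mulrC.
Qed.

End GaussianExpectation.

(** * Directional Gaussian operators *)

Section GaussianOperators.
Variables (R : realType) (k : nat).
Implicit Types (s t a b c M C z : R) (x y v w : 'rV[R]_k) (f g h : 'rV[R]_k -> R).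

Definition l1 v : R := \sum_j `|v ord0 j|.

Lemma l1_ge0 v : 0 <= l1 v.
Proof. by apply: sumr_ge0. Qed.

Lemma l1Z a v : l1 (a *: v) = `|a| * l1 v.
Proof. by rewrite /l1 mulr_sumr; apply: eq_bigr => j _; rewrite mxE normrM. Qed.

(** Both the averaging and the Gaussian operators preserve this class with the same [M] and [C], and
    restriction to a line lands in [lipschitz1]; integrability of every average along a line
    follows. *)
Definition bdlip M C h :=
  (forall x, `|h x| <= M) /\ (forall x y, `|h x - h y| <= C * l1 (x - y)).

Lemma bdlip_line M C h x w : bdlip M C h ->
  lipschitz1 (C * l1 w) (fun z : R => h (x + z *: w)).
Proof.
move=> [_ hC] z z'; rewrite (le_trans (hC _ _))//.
have -> : x + z *: w - (x + z' *: w) = (z - z') *: w.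
  by rewrite opprD addrACA subrr add0r scalerBl.
by rewrite l1Z -mulrA [l1 w * _]mulrC.
Qed.

Lemma bdlip_line_measurable M C h x w : bdlip M C h ->
  measurable_fun setT (fun z : R => h (x + z *: w)).
Proof. by move=> hb; apply: lipschitz1_measurable (bdlip_line x w hb). Qed.

Lemma bdlip_line_integrable s M C h x w : bdlip M C h ->
  gauss_int s (fun z : R => h (x + z *: w)).
Proof.
move=> hb; apply: (gauss_int_bounded _ (M := M)); first exact: bdlip_line_measurable hb.
by move=> z; case: hb.
Qed.

Lemma bdlipD M C h M' C' g : bdlip M C h -> bdlip M' C' g ->
  bdlip (M + M') (C + C') (fun x => h x + g x).
Proof.
move=> [hM hC] [gM gC]; split=> [x|x y].
  by rewrite (le_trans (ler_normD _ _))// lerD.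
by rewrite opprD addrACA (le_trans (ler_normD _ _))// mulrDl lerD.
Qed.

Lemma bdlipZ M C h c : bdlip M C h -> bdlip (`|c| * M) (`|c| * C) (fun x => c * h x).
Proof.
move=> [hM hC]; split=> [x|x y]; first by rewrite normrM ler_wpM2l.
by rewrite -mulrBr normrM -mulrA ler_wpM2l.
Qed.

Lemma bdlip_le M C M' C' h : M <= M' -> C <= C' -> bdlip M C h -> bdlip M' C' h.
Proof.
move=> MM CC [hM hC]; split=> [x|x y]; first exact: le_trans MM.
by rewrite (le_trans (hC _ _))// ler_wpM2r// l1_ge0.
Qed.

Lemma bdlip_shift M C h u : bdlip M C h -> bdlip M C (fun x => h (x + u)).
Proof.
move=> [hM hC]; split=> // x y; rewrite (le_trans (hC _ _))//.
by rewrite opprD addrACA subrr addr0.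
Qed.

(** Averaging over the centred Gaussian carried by the line along [w], whose covariance is [s ^ 2]
    times the rank-one matrix of [w]. *)
Definition gauss_op s w h x : R := gaussE s (fun z : R => h (x + z *: w)).

Lemma gauss_op_bdlip s w M C h : bdlip M C h -> bdlip M C (gauss_op s w h).
Proof.
move=> hb; split=> [x|x y].
  by apply: gaussE_norm_bound; [exact: bdlip_line_measurable hb|case: hb].
rewrite -gaussEB; [|exact: bdlip_line_integrable hb|exact: bdlip_line_integrable hb].
apply: gaussE_norm_bound.
  by apply: measurable_funB; exact: bdlip_line_measurable hb.
move=> z; case: hb => _ hC; rewrite (le_trans (hC _ _))//.
by rewrite opprD addrACA subrr addr0.
Qed.

Lemma gauss_opD s w M C h M' C' g : bdlip M C h -> bdlip M' C' g ->
  gauss_op s w (fun x => h x + g x) = (fun x => gauss_op s w h x + gauss_op s w g x).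
Proof.
move=> hb gb; apply/funext => x; rewrite /gauss_op gaussED//.
  exact: bdlip_line_integrable hb.
exact: bdlip_line_integrable gb.
Qed.

Lemma gauss_opZ s w M C h c : bdlip M C h ->
  gauss_op s w (fun x => c * h x) = (fun x => c * gauss_op s w h x).
Proof.
by move=> hb; apply/funext => x; rewrite /gauss_op gaussEZ//; exact: bdlip_line_integrable hb.
Qed.

Lemma gauss_op_contract s w M C h M' C' g e : bdlip M C h -> bdlip M' C' g ->
  (forall x, `|h x - g x| <= e) ->
  forall x, `|gauss_op s w h x - gauss_op s w g x| <= e.
Proof.
move=> hb gb hg x.
rewrite /gauss_op -gaussEB; [|exact: bdlip_line_integrable hb|exact: bdlip_line_integrable gb].
apply: gaussE_norm_bound => [|z]; last exact: hg.
apply: measurable_funB; first exact: bdlip_line_measurable hb.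
exact: bdlip_line_measurable gb.
Qed.

Lemma gauss_op_conv s t r w M C h : 0 < s -> 0 < t -> 0 < r ->
  s ^+ 2 + t ^+ 2 = r ^+ 2 -> bdlip M C h ->
  gauss_op s w (gauss_op t w h) = gauss_op r w h.
Proof.
move=> s0 t0 r0 str hb; apply/funext => x; rewrite /gauss_op.
have := @gaussE_conv _ s t _ M _ s0 t0 (bdlip_line x w hb).
rewrite str sqrtr_sqr gtr0_norm// => <-; last by case: hb.
congr gaussE; apply/funext => y; congr gaussE; apply/funext => z.
by rewrite scalerDl addrA.
Qed.

Lemma gauss_op_comm s t w v M C h : 0 < s -> 0 < t -> bdlip M C h -> 0 <= C ->
  gauss_op s w (gauss_op t v h) = gauss_op t v (gauss_op s w h).
Proof.
move=> s0 t0 hb C0; apply/funext => x; rewrite /gauss_op.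
transitivity (gaussE t (fun z : R => gaussE s (fun y : R => h (x + y *: w + z *: v)))); last first.
  congr gaussE; apply/funext => z; congr gaussE; apply/funext => y.
  by rewrite addrAC.
apply: (@gaussE_swap _ s t (fun y z : R => h (x + y *: w + z *: v)) M (C * (l1 w + l1 v))) => //.
- by case: hb.
- by rewrite mulr_ge0// addr_ge0 ?l1_ge0.
- move=> z y y' /=; have := bdlip_line (x + z *: v) w hb y y'.
  rewrite ![x + z *: v + _]addrAC => h1; rewrite (le_trans h1)//.
  by rewrite ler_wpM2r// ler_wpM2l// lerDl l1_ge0.
- move=> y z z'; rewrite (le_trans (bdlip_line (x + y *: w) v hb z z'))//.
  by rewrite ler_wpM2r// ler_wpM2l// lerDr l1_ge0.
Qed.

(** Composing such operators adds rank-one covariances. The common factor [a] rescales the whole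
    Gaussian, so that one list [ws] serves both for the single step and for the limit. *)
Definition gauss_ops a (ws : seq (R * 'rV[R]_k)) h :=
  foldr (fun p g => gauss_op (a * p.1) p.2 g) h ws.

Definition pos_scales (ws : seq (R * 'rV[R]_k)) := all (fun p => 0 < p.1) ws.

Lemma gauss_ops_bdlip a ws M C h : bdlip M C h -> bdlip M C (gauss_ops a ws h).
Proof. by move=> hb; elim: ws => //= p ws ih; exact: gauss_op_bdlip. Qed.

Lemma gauss_opsZ a ws M C h c : bdlip M C h ->
  gauss_ops a ws (fun x => c * h x) = (fun x => c * gauss_ops a ws h x).
Proof.
move=> hb; elim: ws => //= p ws ->.
exact: gauss_opZ (gauss_ops_bdlip a ws hb).
Qed.

Lemma gauss_ops_contract a ws M C h M' C' g e : bdlip M C h -> bdlip M' C' g ->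
  (forall x, `|h x - g x| <= e) ->
  forall x, `|gauss_ops a ws h x - gauss_ops a ws g x| <= e.
Proof.
move=> hb gb hg; elim: ws => //= p ws ih.
exact: gauss_op_contract (gauss_ops_bdlip a ws hb) (gauss_ops_bdlip a ws gb) ih.
Qed.

Lemma gauss_op_opsC s w a ws M C h : 0 < s -> 0 < a -> pos_scales ws ->
  bdlip M C h -> 0 <= C -> gauss_op s w (gauss_ops a ws h) = gauss_ops a ws (gauss_op s w h).
Proof.
move=> s0 a0 + hb C0; elim: ws => //= p ws ih /andP[p0 wsp].
rewrite (gauss_op_comm _ _ _ _ (gauss_ops_bdlip a ws hb))//; last by rewrite mulr_gt0.
by rewrite ih.
Qed.

(** Variances add along a single direction, so the second head factor is first commuted past the
    first tail to meet the factor with its own direction. *)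
Lemma gauss_ops_conv a b c ws M C h : 0 < a -> 0 < b -> 0 < c ->
  a ^+ 2 + b ^+ 2 = c ^+ 2 -> pos_scales ws ->
  bdlip M C h -> 0 <= C -> gauss_ops a ws (gauss_ops b ws h) = gauss_ops c ws h.
Proof.
move=> a0 b0 c0 abc + hb C0; elim: ws => [//|p ws ih] /= /andP[p0 wsp].
have bp0 : 0 < b * p.1 by rewrite mulr_gt0.
have ap0 : 0 < a * p.1 by rewrite mulr_gt0.
have cp0 : 0 < c * p.1 by rewrite mulr_gt0.
rewrite -(gauss_op_opsC _ bp0 a0 wsp (gauss_ops_bdlip b ws hb) C0).
rewrite (gauss_op_conv _ ap0 bp0 cp0 _ (gauss_ops_bdlip a ws (gauss_ops_bdlip b ws hb))).
  by rewrite (ih wsp).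
by rewrite !exprMn -mulrDl abc.
Qed.

Lemma iter_gauss_ops n a b ws M C h : 0 < a -> 0 < b -> n.+1%:R * a ^+ 2 = b ^+ 2 ->
  pos_scales ws -> bdlip M C h -> 0 <= C ->
  iter n.+1 (gauss_ops a ws) h = gauss_ops b ws h.
Proof.
move=> a0 + + wsp hb C0; elim: n b => [|n ih] b b0 ab.
  have -> : b = a; last by [].
  apply/eqP; rewrite -(@eqrXn2 _ 2)//; [|exact: ltW|exact: ltW].
  by rewrite -ab mul1r.
have [c c0 cE] : exists2 c : R, 0 < c & n.+1%:R * a ^+ 2 = c ^+ 2.
  exists (Num.sqrt (n.+1%:R * a ^+ 2)); rewrite ?sqrtr_gt0 ?mulr_gt0 ?exprn_gt0//.
  by rewrite sqr_sqrtr// mulr_ge0// sqr_ge0.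
rewrite iterS (ih c c0 cE); apply: (gauss_ops_conv a0 c0 b0 _ wsp hb C0).
by rewrite -ab -cE -[in RHS]nat1r mulrDl mul1r.
Qed.

End GaussianOperators.

(** * Taylor-controlled test functions *)

Section SmoothClass.
Variables (R : realType) (k : nat).
Notation V := 'rV[R]_k.
Implicit Types (C a : R) (x v : V) (f g : V -> R).
Implicit Types (D : 'I_k -> V -> R) (B : 'I_k -> 'I_k -> V -> R).

Definition lin D x v := \sum_i D i x * v ord0 i.
Definition quad B x v := \sum_i \sum_j B i j x * (v ord0 i * v ord0 j).

(* [B] is half the Hessian of [f]. *)
Record tsmooth C f D B : Prop := TSmooth {
  ts_bdlip : bdlip C C f;
  ts_lipD : forall i, bdlip C C (D i);
  ts_lipB : forall i j, bdlip C C (B i j);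
  ts_order2 : forall x v, `|f (x + v) - f x - lin D x v| <= C * l1 v ^+ 2;
  ts_order3 : forall x v,
    `|f (x + v) - f x - lin D x v - quad B x v| <= C * l1 v ^+ 3 }.

Lemma tsmooth_le C C' f D B : C <= C' -> tsmooth C f D B -> tsmooth C' f D B.
Proof.
move=> CC [b bD bB o2 o3]; split=> *.
- exact: bdlip_le b.
- exact: bdlip_le (bD _).
- exact: bdlip_le (bB _ _).
- by rewrite (le_trans (o2 _ _))// ler_wpM2r// exprn_ge0// l1_ge0.
- by rewrite (le_trans (o3 _ _))// ler_wpM2r// exprn_ge0// l1_ge0.
Qed.

Lemma ts_ge0 C f D B : tsmooth C f D B -> 0 <= C.
Proof. by case=> [[fC _] _ _ _ _]; rewrite (le_trans _ (fC 0)). Qed.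

Lemma lin_bound D x v C : (forall i y, `|D i y| <= C) ->
  `|lin D x v| <= C * l1 v.
Proof.
move=> DC; rewrite (le_trans (ler_norm_sum _ _ _))// /l1 mulr_sumr.
by apply: ler_sum => i _; rewrite normrM ler_wpM2r.
Qed.

Lemma l1_sqr v : l1 v ^+ 2 = \sum_i \sum_j `|v ord0 i * v ord0 j|.
Proof.
rewrite expr2 {1}/l1 mulr_suml; apply: eq_bigr => i _.
by rewrite /l1 mulr_sumr; apply: eq_bigr => j _; rewrite normrM.
Qed.

Lemma quad_bdlip B w C : (forall i j, bdlip C C (B i j)) ->
  bdlip (C * l1 w ^+ 2) (C * l1 w ^+ 2) (fun x => quad B x w).
Proof.
move=> BC; split=> [x|x y].
  rewrite (le_trans (ler_norm_sum _ _ _))// l1_sqr mulr_sumr.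
  apply: ler_sum => i _; rewrite (le_trans (ler_norm_sum _ _ _))// mulr_sumr.
  by apply: ler_sum => j _; rewrite normrM ler_wpM2r//; case: (BC i j).
rewrite /quad -sumrB (le_trans (ler_norm_sum _ _ _))//.
rewrite mulrAC l1_sqr mulr_sumr; apply: ler_sum => i _.
rewrite -sumrB (le_trans (ler_norm_sum _ _ _))// mulr_sumr.
apply: ler_sum => j _; rewrite -mulrBl normrM ler_wpM2r//.
by case: (BC i j).
Qed.

Lemma linZ D x a v : lin D x (a *: v) = a * lin D x v.
Proof.
by rewrite mulr_sumr; apply: eq_bigr => i _; rewrite mxE mulrCA.
Qed.

Lemma quadZ B x a v : quad B x (a *: v) = a ^+ 2 * quad B x v.
Proof.
rewrite mulr_sumr; apply: eq_bigr => i _; rewrite mulr_sumr.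
by apply: eq_bigr => j _; rewrite !mxE; ring.
Qed.

Lemma bdlipM C f g : bdlip C C f -> bdlip C C g ->
  bdlip (C ^+ 2) (2 * C ^+ 2) (fun x => f x * g x).
Proof.
move=> [fM fC] [gM gC].
have C0 : 0 <= C by rewrite (le_trans _ (fM 0)).
split=> [x|x y]; first by rewrite normrM expr2 ler_pM.
have -> : f x * g x - f y * g y = f x * (g x - g y) + (f x - f y) * g y by ring.
have -> : 2 * C ^+ 2 * l1 (x - y) = C * (C * l1 (x - y)) + (C * l1 (x - y)) * C by ring.
by rewrite (le_trans (ler_normD _ _))// !normrM lerD// ler_pM.
Qed.

(** The third-order remainder of a product contains second-order remainders multiplied by
    first-order increments, which is why [tsmooth] also records [ts_order2]. The term
    [D i x * D' j x] is left unsymmetrized because only the quadratic form of [B] matters. The 6 is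
    the Lipschitz cost of the three products in the new [B], at 2 each. *)
Lemma tsmoothM C f D B g D' B' : tsmooth C f D B -> tsmooth C g D' B' ->
  tsmooth (6 * C ^+ 2) (fun x => f x * g x)
    (fun i x => f x * D' i x + g x * D i x)
    (fun i j x => f x * B' i j x + (g x * B i j x + D i x * D' j x)).
Proof.
move=> tf tg; have C0 := ts_ge0 tf.
case: tf => [bf bD bB f2 f3]; case: tg => [bg bD' bB' g2 g3].
have linE x v : lin (fun i x => f x * D' i x + g x * D i x) x v =
    f x * lin D' x v + g x * lin D x v.
  by rewrite /lin !mulr_sumr -big_split; apply: eq_bigr => i _ /=; ring.
have quadE x v : quad (fun i j x => f x * B' i j x + (g x * B i j x + D i x * D' j x)) x v =
    f x * quad B' x v + (g x * quad B x v + lin D x v * lin D' x v).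
  rewrite /quad /lin mulr_suml !mulr_sumr -!big_split; apply: eq_bigr => i _ /=.
  rewrite !mulr_sumr -!big_split; apply: eq_bigr => j _ /=; ring.
have C2 : 0 <= C ^+ 2 by rewrite exprn_ge0.
have ff x : `|f x| <= C by case: bf.
have gg x : `|g x| <= C by case: bg.
have f1 x v : `|f (x + v) - f x| <= C * l1 v.
  by case: bf => _ /(_ (x + v) x); rewrite addrAC subrr add0r.
have g1 x v : `|g (x + v) - g x| <= C * l1 v.
  by case: bg => _ /(_ (x + v) x); rewrite addrAC subrr add0r.
have l0 v : 0 <= C * l1 v by rewrite mulr_ge0// l1_ge0.
have Lf x v : `|lin D x v| <= C * l1 v.
  by apply: lin_bound => i y; case: (bD i).
split.
- by apply: bdlip_le (bdlipM bf bg); lra.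
- move=> i; apply: bdlip_le (bdlipD (bdlipM bf (bD' i)) (bdlipM bg (bD i))); lra.
- move=> i j.
  have bgD := bdlipD (bdlipM bg (bB i j)) (bdlipM (bD i) (bD' j)).
  apply: bdlip_le (bdlipD (bdlipM bf (bB' i j)) bgD); lra.
- move=> x v; rewrite linE; set a := f (x + v) in f1 *; set b := g (x + v).
  have -> : a * b - f x * g x - (f x * lin D' x v + g x * lin D x v) =
     f x * (b - g x - lin D' x v) + g x * (a - f x - lin D x v) +
     (a - f x) * (b - g x) by ring.
  have -> : 6 * C ^+ 2 * l1 v ^+ 2 = C * (C * l1 v ^+ 2) + C * (C * l1 v ^+ 2) +
     (C * l1 v) * (C * l1 v) + 3 * (C ^+ 2 * l1 v ^+ 2) by ring.
  rewrite -[leLHS]addr0 lerD ?mulr_ge0 ?exprn_ge0 ?l1_ge0//.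
  rewrite (le_trans (ler_normD _ _))// lerD//; last by rewrite normrM ler_pM// ?f1 ?g1.
  rewrite (le_trans (ler_normD _ _))// !normrM.
  by apply: lerD; apply: ler_pM => //; [exact: g2|exact: f2].
- move=> x v; rewrite linE quadE; set a := f (x + v); set b := g (x + v).
  have -> : a * b - f x * g x - (f x * lin D' x v + g x * lin D x v) -
     (f x * quad B' x v + (g x * quad B x v + lin D x v * lin D' x v)) =
     f x * (b - g x - lin D' x v - quad B' x v) +
     g x * (a - f x - lin D x v - quad B x v) +
     ((a - f x - lin D x v) * (b - g x) + lin D x v * (b - g x - lin D' x v)) by ring.
  have -> : 6 * C ^+ 2 * l1 v ^+ 3 = C * (C * l1 v ^+ 3) + C * (C * l1 v ^+ 3) +
     ((C * l1 v ^+ 2) * (C * l1 v) + (C * l1 v) * (C * l1 v ^+ 2)) +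
     2 * (C ^+ 2 * l1 v ^+ 3) by ring.
  rewrite -[leLHS]addr0 lerD ?mulr_ge0 ?exprn_ge0 ?l1_ge0//.
  rewrite (le_trans (ler_normD _ _))//.
  apply: lerD; rewrite (le_trans (ler_normD _ _))// !normrM; apply: lerD; apply: ler_pM => //.
  + exact: g3.
  + exact: f3.
  + exact: f2.
  + exact: g1.
  + exact: g2.
Qed.

Lemma tsmooth_cst1 : tsmooth 1 (fun=> 1) (fun _ _ => 0) (fun _ _ _ => 0).
Proof.
have l0 (v : V) : 0 <= l1 v := l1_ge0 v.
split=> [|i|i j|x v|x v].
- by split=> [x|x y]; rewrite ?normr1// subrr normr0 mul1r.
- by split=> [x|x y]; rewrite ?subrr normr0 ?mul1r.
- by split=> [x|x y]; rewrite ?subrr normr0 ?mul1r.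
- by rewrite /lin big1 ?subrr ?subr0 ?normr0 ?mul1r ?exprn_ge0// => i _; rewrite mul0r.
- rewrite /lin /quad !big1 ?subrr ?subr0 ?normr0 ?mul1r ?exprn_ge0//.
    by move=> i _; rewrite big1// => j _; rewrite mul0r.
  by move=> i _; rewrite mul0r.
Qed.

Lemma tsmooth_prod (I : Type) (s : seq I) (F : I -> V -> R) :
  (forall i, exists C D B, tsmooth C (F i) D B) ->
  exists C D B, tsmooth C (fun x => \prod_(i <- s) F i x) D B.
Proof.
move=> sF; elim: s => [|i s [C [D [B tC]]]].
  have := tsmooth_cst1; set f := fun=> 1; have -> : f = (fun x => \prod_(i <- [::]) F i x).
    by apply/funext => x; rewrite big_nil.
  by move=> t; do 3 eexists; exact: t.
have [C' [D' [B' tC']]] := sF i.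
have tm := tsmooth_le (ltac:(by rewrite le_max lexx) : C' <= Num.max C' C) tC'.
have tm' := tsmooth_le (ltac:(by rewrite le_max lexx orbT) : C <= Num.max C' C) tC.
have := tsmoothM tm tm'.
have -> : (fun x => F i x * \prod_(i <- s) F i x) = (fun x => \prod_(i <- i :: s) F i x).
  by apply/funext => x; rewrite big_cons.
by move=> t; do 3 eexists; exact: t.
Qed.

Definition delta1 (j i : 'I_k) : R := (i == j)%:R.

Lemma l1_coord v j : `|v ord0 j| <= l1 v.
Proof. by rewrite /l1 (bigD1 j)//= lerDl sumr_ge0. Qed.

Lemma tsmooth_coord C (g g1 g2 : R -> R) j : 0 <= C ->
  (forall x : R, `|g x| <= C) -> (forall x : R, `|g1 x| <= C) -> (forall x : R, `|g2 x| <= C) ->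
  lipschitz1 C g -> lipschitz1 C g1 -> lipschitz1 C g2 ->
  (forall x h : R, `|g (x + h) - g x - g1 x * h| <= C * `|h| ^+ 2) ->
  (forall x h : R, `|g (x + h) - g x - g1 x * h - g2 x * h ^+ 2| <= C * `|h| ^+ 3) ->
  tsmooth C (fun x => g (x ord0 j)) (fun i x => delta1 j i * g1 (x ord0 j))
    (fun i i' x => delta1 j i * delta1 j i' * g2 (x ord0 j)).
Proof.
move=> C0 gC g1C g2C gL g1L g2L o2 o3.
have blc (h : R -> R) (c : R) : 0 <= c <= 1 -> (forall x : R, `|h x| <= C) ->
    lipschitz1 C h -> bdlip C C (fun x => c * h (x ord0 j)).
  move=> /andP[c0 c1] hC hL; split=> [x|x y].
    by rewrite normrM ger0_norm// -[leRHS]mul1r ler_pM.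
  rewrite -mulrBr normrM ger0_norm// -[leRHS]mul1r ler_pM//.
  rewrite (le_trans (hL _ _))// ler_wpM2l//.
  by have := l1_coord (x - y) j; rewrite !mxE.
have d01 i : 0 <= delta1 j i <= 1 by rewrite /delta1 ler0n lern1 leq_b1.
have linE x v : lin (fun i x => delta1 j i * g1 (x ord0 j)) x v = g1 (x ord0 j) * v ord0 j.
  rewrite /lin (bigD1 j)//= /delta1 eqxx mul1r big1 ?addr0// => i /negbTE ->.
  by rewrite !mul0r.
have quadE x v : quad (fun i i' x => delta1 j i * delta1 j i' * g2 (x ord0 j)) x v =
    g2 (x ord0 j) * v ord0 j ^+ 2.
  rewrite /quad (bigD1 j)//= (bigD1 j)//= /delta1 eqxx !mul1r -expr2.
  rewrite big1 ?addr0; last by move=> i /negbTE ->; rewrite mulr0 !mul0r.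
  rewrite big1 ?addr0// => i /negbTE ->.
  by rewrite big1// => i' _; rewrite !mul0r.
split.
- have := blc g 1 _ gC gL; rewrite ler01 lexx => /(_ isT).
  by congr bdlip; apply/funext => x; rewrite mul1r.
- by move=> i; exact: blc.
- move=> i i'; apply: blc => //.
  have /andP[a0 a1] := d01 i; have /andP[b0 b1] := d01 i'.
  by rewrite mulr_ge0//= -[leRHS]mul1r ler_pM.
- move=> x v; rewrite linE mxE (le_trans (o2 _ _))// ler_wpM2l// lerXn2r ?nnegrE ?l1_ge0//.
  exact: l1_coord.
- move=> x v; rewrite linE quadE mxE (le_trans (o3 _ _))// ler_wpM2l// lerXn2r ?nnegrE ?l1_ge0//.
  exact: l1_coord.
Qed.

End SmoothClass.

(** * The cubic spline step and its Taylor bounds *)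

Section Spline.
Variable R : realType.
Implicit Types (x h N : R).

Definition ppart x : R := Num.max x 0.

Lemma ppart_pos x : 0 <= x -> ppart x = x.
Proof. by move=> x0; apply/max_idPl. Qed.

Lemma ppart_neg x : x <= 0 -> ppart x = 0.
Proof. by move=> x0; apply/max_idPr. Qed.

Lemma ppart_lip x h : `|ppart (x + h) - ppart x| <= `|h|.
Proof.
rewrite ler_norml; have := ler_norm h; have := ler_norm (- h); rewrite normrN.
have [x0|/ltW x0] := leP 0 x; have [y0|/ltW y0] := leP 0 (x + h);
  rewrite ?(ppart_pos x0) ?(ppart_neg x0) ?(ppart_pos y0) ?(ppart_neg y0) => ? ?;
  apply/andP; split; lra.
Qed.

(** The derivative [2 * ppart] of the square is 2-Lipschitz, so the kink does not spoil the
    remainder [h ^ 2]. Likewise the second derivative [6 * ppart] of the cube is 6-Lipschitz, whence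
    [|h| ^ 3] in the next lemma. *)
Lemma ppart_sqr x h : `|ppart (x + h) ^+ 2 - ppart x ^+ 2 - 2 * ppart x * h| <= h ^+ 2.
Proof.
have [x0|/ltW x0] := leP 0 x; have [y0|/ltW y0] := leP 0 (x + h);
  rewrite ?(ppart_pos x0) ?(ppart_neg x0) ?(ppart_pos y0) ?(ppart_neg y0) ler_norml;
  apply/andP; split; nra.
Qed.

Lemma ppart_cube x h :
  `|ppart (x + h) ^+ 3 - ppart x ^+ 3 - 3 * ppart x ^+ 2 * h - 3 * ppart x * h ^+ 2|
    <= `|h| ^+ 3.
Proof.
have [x0|/ltW x0] := leP 0 x; have [y0|/ltW y0] := leP 0 (x + h);
  rewrite ?(ppart_pos x0) ?(ppart_neg x0) ?(ppart_pos y0) ?(ppart_neg y0).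
- by rewrite (_ : _ - _ = h ^+ 3) ?normrX//; ring.
- have -> : 0 ^+ 3 - x ^+ 3 - 3 * x ^+ 2 * h - 3 * x * h ^+ 2 =
    (- (x + h)) ^+ 3 - (- h) ^+ 3 by ring.
  have h0 : h <= 0 by lra.
  have b0 : 0 <= - (x + h) by lra.
  have a0 : 0 <= - h by lra.
  have ab : (- (x + h)) ^+ 3 <= (- h) ^+ 3 by rewrite lerXn2r ?nnegrE//; lra.
  have := exprn_ge0 3 b0; rewrite (ler0_norm h0) ler_norml => ?.
  by apply/andP; split; lra.
- have h0 : 0 <= h by lra.
  rewrite (ger0_norm h0) (_ : _ - 3 * 0 * h ^+ 2 = (x + h) ^+ 3); last by ring.
  rewrite ger0_norm ?exprn_ge0//.
  by rewrite lerXn2r ?nnegrE//; lra.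
- by rewrite !(expr0n, mul0r, mulr0, subr0)/= ?mul0r ?subr0 normr0 exprn_ge0.
Qed.

(* [step] rises from 0 on (-oo, 0] to 1 on [3, +oo); its derivative [dstep] is
   the quadratic B-spline with knots 0, 1, 2, 3, and [ddstep] is half its second
   derivative. *)
Definition step x : R :=
  (ppart x ^+ 3 - 3 * ppart (x - 1) ^+ 3 + 3 * ppart (x - 2) ^+ 3 - ppart (x - 3) ^+ 3) / 6.
Definition dstep x : R :=
  (ppart x ^+ 2 - 3 * ppart (x - 1) ^+ 2 + 3 * ppart (x - 2) ^+ 2 - ppart (x - 3) ^+ 2) / 2.
Definition ddstep x : R :=
  (ppart x - 3 * ppart (x - 1) + 3 * ppart (x - 2) - ppart (x - 3)) / 2.

Lemma step_le0 x : x <= 0 -> step x = 0.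
Proof.
move=> x0; rewrite /step !ppart_neg; [|lra..]; ring.
Qed.

(** Beyond the last knot the numerator is a third difference of the cube, equal to 6. *)
Lemma step_ge3 x : 3 <= x -> step x = 1.
Proof.
move=> x0; rewrite /step !ppart_pos; [by field|lra..].
Qed.

Lemma step_bounds x : [/\ 0 <= step x <= 1, `|dstep x| <= 1 & `|ddstep x| <= 1].
Proof.
rewrite /step /dstep /ddstep !ler_norml.
have [x0|/ltW x0] := leP x 0.
  by rewrite !ppart_neg; [split; apply/andP; split; lra|lra..].
have [x1|/ltW x1] := leP x 1.
  rewrite ppart_pos// !ppart_neg; [split; apply/andP; split; nra|lra..].
have [x2|/ltW x2] := leP x 2.
  have [y y0 ->] : exists2 y, 0 <= y <= 1 & x = y + 1.
    by exists (x - 1); [apply/andP; split; lra|ring].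
  case/andP: y0 => y0 y1.
  rewrite (_ : y + 1 - 1 = y); last by ring.
  rewrite (ppart_pos y0) (@ppart_pos (y + 1)); last by lra.
  rewrite !ppart_neg; [split; apply/andP; split; nra|lra..].
have [x3|/ltW x3] := leP x 3.
  (* Measured from the right end, [step] is [1 - y ^ 3 / 6] on this piece. *)
  have [y y0 ->] : exists2 y, 0 <= y <= 1 & x = 3 - y.
    by exists (3 - x); [apply/andP; split; lra|ring].
  case/andP: y0 => y0 y1.
  rewrite (@ppart_pos (3 - y)); last by lra.
  rewrite (@ppart_pos (3 - y - 1)); last by lra.
  rewrite (@ppart_pos (3 - y - 2)); last by lra.
  rewrite ppart_neg; last by lra.
  split; apply/andP; split; nra.
rewrite !ppart_pos; [split; apply/andP; split; lra|lra..].
Qed.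

(** The coefficients 1, 3, 3, 1 add up to 8, and the denominator halves this. The same count gives
    the 4 of [dstep_taylor] and, with room to spare, that of [step_taylor3]. *)
Lemma ddstep_lip x h : `|ddstep (x + h) - ddstep x| <= 4 * `|h|.
Proof.
have P y : - `|h| <= ppart (y + h) - ppart y <= `|h| by rewrite -ler_norml ppart_lip.
rewrite /ddstep ![x + h - _]addrAC ler_norml.
have /andP[] := P x; have /andP[] := P (x - 1).
have /andP[] := P (x - 2); have /andP[] := P (x - 3).
move=> *; apply/andP; split; lra.
Qed.

Lemma dstep_taylor x h : `|dstep (x + h) - dstep x - 2 * ddstep x * h| <= 4 * h ^+ 2.
Proof.
have P y : _ /\ _ := andP (etrans (esym (ler_norml _ _)) (ppart_sqr y h)).
rewrite /dstep /ddstep ![x + h - _]addrAC ler_norml.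
have [] := P x; have [] := P (x - 1); have [] := P (x - 2); have [] := P (x - 3).
move=> *; apply/andP; split; lra.
Qed.

Lemma step_taylor3 x h :
  `|step (x + h) - step x - dstep x * h - ddstep x * h ^+ 2| <= 4 * `|h| ^+ 3.
Proof.
have P y : _ /\ _ := andP (etrans (esym (ler_norml _ _)) (ppart_cube y h)).
rewrite /step /dstep /ddstep ![x + h - _]addrAC ler_norml.
have [] := P x; have [] := P (x - 1); have [] := P (x - 2); have [] := P (x - 3).
have : 0 <= `|h| ^+ 3 by rewrite exprn_ge0.
move=> *; apply/andP; split; lra.
Qed.

(** For [|h| <= 1] the next Taylor bound suffices, higher powers of [|h|] being absorbed by lower
    ones; for larger [h] the sup bounds do. The next two lemmas descend in the same way, so the
    constants accumulate to 6 and 7. *)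
Lemma dstep_lip x h : `|dstep (x + h) - dstep x| <= 6 * `|h|.
Proof.
have [_ b1 b2] := step_bounds x; have [_ b1' _] := step_bounds (x + h).
set a := `|h|; have a0 : 0 <= a by exact: normr_ge0.
have [h1|/ltW h1] := leP a 1; last first.
  rewrite (le_trans (ler_normB _ _))//; lra.
have -> : dstep (x + h) - dstep x =
  (dstep (x + h) - dstep x - 2 * ddstep x * h) + 2 * ddstep x * h by ring.
rewrite (le_trans (ler_normD _ _))//.
have := dstep_taylor x h; rewrite -(real_normK (num_real h)) -/a => t1.
have t2 : `|2 * ddstep x * h| <= 2 * a.
  rewrite -mulrA normrM (ger0_norm (ler0n _ 2)) ler_wpM2l//.
  by rewrite [`|_ * h|]normrM -[leRHS]mul1r ler_wpM2r.
nra.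
Qed.

Lemma step_taylor2 x h : `|step (x + h) - step x - dstep x * h| <= 6 * `|h| ^+ 2.
Proof.
have [b0 b1 b2] := step_bounds x; have [b0' _ _] := step_bounds (x + h).
set a := `|h|; have a0 : 0 <= a by exact: normr_ge0.
have d1 : `|dstep x * h| <= a by rewrite normrM -[leRHS]mul1r ler_wpM2r.
have [h1|/ltW h1] := leP a 1; last first.
  rewrite (le_trans (ler_normB _ _))//.
  have : `|step (x + h) - step x| <= 1 by rewrite ler_norml; lra.
  nra.
have -> : step (x + h) - step x - dstep x * h =
  (step (x + h) - step x - dstep x * h - ddstep x * h ^+ 2) + ddstep x * h ^+ 2 by ring.
rewrite (le_trans (ler_normD _ _))//.
have := step_taylor3 x h; rewrite normrM normrX -/a => t3.
have : `|ddstep x| * a ^+ 2 <= a ^+ 2 by rewrite -[leRHS]mul1r ler_wpM2r// exprn_ge0.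
nra.
Qed.

Lemma step_lip x h : `|step (x + h) - step x| <= 7 * `|h|.
Proof.
have [b0 b1 b2] := step_bounds x; have [b0' _ _] := step_bounds (x + h).
set a := `|h|; have a0 : 0 <= a by exact: normr_ge0.
have d1 : `|dstep x * h| <= a by rewrite normrM -[leRHS]mul1r ler_wpM2r.
have [h1|/ltW h1] := leP a 1; last first.
  have : `|step (x + h) - step x| <= 1 by rewrite ler_norml; lra.
  lra.
have -> : step (x + h) - step x =
  (step (x + h) - step x - dstep x * h) + dstep x * h by ring.
rewrite (le_trans (ler_normD _ _))//.
have := step_taylor2 x h; rewrite -/a; nra.
Qed.

(** Each derivative costs a factor [N]. The worst case is the Lipschitz bound on the second
    derivative, of order [N ^ 3], and [1 <= N] lets [7 * N ^ 3] cover all the others. *)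
Lemma tsmooth_step k N (j : 'I_k) : 1 <= N ->
  exists C D B, tsmooth C (fun x : 'rV[R]_k => step (N * x ord0 j)) D B.
Proof.
move=> N1; have N0 : 0 <= N by lra.
have NN : N <= N ^+ 2 by nra.
have NN2 : N ^+ 2 <= N ^+ 3 by nra.
have Nn y : `|N * y| = N * `|y| by rewrite normrM ger0_norm.
exists (7 * N ^+ 3); eexists; eexists.
apply: (@tsmooth_coord R k _ (fun y => step (N * y)) (fun y => N * dstep (N * y))
  (fun y => N ^+ 2 * ddstep (N * y)) j).
- by rewrite mulr_ge0// exprn_ge0.
- by move=> y; have [b _ _] := step_bounds (N * y); rewrite ler_norml; lra.
- by move=> y; have [_ b _] := step_bounds (N * y); rewrite Nn; nra.
- move=> y; have [_ _ b] := step_bounds (N * y); rewrite normrM ger0_norm ?exprn_ge0//; nra.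
- move=> y z; have := step_lip (N * z) (N * (y - z)); rewrite Nn -mulrDr subrKC.
  have := normr_ge0 (y - z); nra.
- move=> y z; have := dstep_lip (N * z) (N * (y - z)); rewrite Nn -mulrDr subrKC.
  rewrite -mulrBr Nn; have := normr_ge0 (y - z); nra.
- move=> y z; have := ddstep_lip (N * z) (N * (y - z)); rewrite Nn -mulrDr subrKC.
  rewrite -mulrBr normrM (ger0_norm (exprn_ge0 2 N0)); have := normr_ge0 (y - z) => a0 t.
  have : N ^+ 2 * `|ddstep (N * y) - ddstep (N * z)| <= N ^+ 2 * (4 * (N * `|y - z|)).
    by rewrite ler_wpM2l// exprn_ge0.
  nra.
- move=> y h; have := step_taylor2 (N * y) (N * h); rewrite Nn -mulrDr.
  rewrite (_ : N * dstep (N * y) * h = dstep (N * y) * (N * h)); last by ring.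
  move=> t; rewrite (le_trans t)// exprMn mulrA ler_wpM2r ?sqr_ge0//; lra.
- move=> y h; have := step_taylor3 (N * y) (N * h); rewrite Nn -mulrDr.
  rewrite (_ : N * dstep (N * y) * h = dstep (N * y) * (N * h)); last by ring.
  rewrite (_ : N ^+ 2 * ddstep (N * y) * h ^+ 2 = ddstep (N * y) * (N * h) ^+ 2); last by ring.
  move=> t; rewrite (le_trans t)// exprMn mulrA ler_wpM2r ?exprn_ge0//.
  by rewrite ler_wpM2r ?exprn_ge0//; lra.
Qed.

End Spline.

(** * Comparison of one step with its Gaussian counterpart *)

Section Trotter.
Variables (R : realType) (k : nat) (T : finType).
Notation V := 'rV[R]_k.
Variables (p : T -> R) (X : T -> V).
Hypothesis p_ge0 : forall r, 0 <= p r.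
Hypothesis p_sum1 : \sum_r p r = 1.
Implicit Types (a C s : R) (x w : V) (f g h : V -> R).
Implicit Types (D : 'I_k -> V -> R) (B : 'I_k -> 'I_k -> V -> R).

Definition avg_op a f x := \sum_r p r * f (x + a *: X r).

Lemma avg_norm_le (F : T -> R) M : (forall r, `|F r| <= M) ->
  `|\sum_r p r * F r| <= M.
Proof.
move=> FM; rewrite (le_trans (ler_norm_sum _ _ _))//.
rewrite -[leRHS]mul1r -p_sum1 mulr_suml; apply: ler_sum => r _.
by rewrite normrM ger0_norm// ler_wpM2l.
Qed.

Lemma avg_cst (c : R) : \sum_r p r * c = c.
Proof. by rewrite -mulr_suml p_sum1 mul1r. Qed.

Lemma avg_op_bdlip a M C f : bdlip M C f -> bdlip M C (avg_op a f).
Proof.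
move=> [fM fC]; split=> [x|x y]; first exact: avg_norm_le.
rewrite /avg_op -sumrB; under eq_bigr do rewrite -mulrBr.
apply: avg_norm_le => r; rewrite (le_trans (fC _ _))//.
by rewrite opprD addrACA subrr addr0.
Qed.

Lemma lin_avg a D x v : lin (fun i => avg_op a (D i)) x v = \sum_r p r * lin D (x + a *: X r) v.
Proof.
rewrite /lin /avg_op; under eq_bigr do rewrite mulr_suml.
rewrite exchange_big; apply: eq_bigr => r _.
by rewrite mulr_sumr; apply: eq_bigr => i _; rewrite mulrA.
Qed.

Lemma quad_avg a B x v :
  quad (fun i j => avg_op a (B i j)) x v = \sum_r p r * quad B (x + a *: X r) v.
Proof.
rewrite /quad /avg_op; under eq_bigr do under eq_bigr do rewrite mulr_suml.
under eq_bigr do rewrite exchange_big.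
rewrite exchange_big; apply: eq_bigr => r _.
rewrite mulr_sumr; apply: eq_bigr => i _.
by rewrite mulr_sumr; apply: eq_bigr => j _; rewrite -mulrA.
Qed.

(** A convex combination of translates inherits the expansion with the same [C], so the one-step
    estimate is uniform along all iterates. *)
Lemma avg_op_tsmooth a C f D B : tsmooth C f D B ->
  tsmooth C (avg_op a f) (fun i => avg_op a (D i)) (fun i j => avg_op a (B i j)).
Proof.
case=> [bf bD bB f2 f3]; split.
- exact: avg_op_bdlip.
- by move=> i; exact: avg_op_bdlip.
- by move=> i j; exact: avg_op_bdlip.
- move=> x v; rewrite lin_avg /avg_op -!sumrB; under eq_bigr do rewrite -!mulrBr.
  by apply: avg_norm_le => r; rewrite (addrAC x v); exact: f2.
- move=> x v; rewrite lin_avg quad_avg /avg_op -!sumrB; under eq_bigr do rewrite -!mulrBr.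
  by apply: avg_norm_le => r; rewrite (addrAC x v); exact: f3.
Qed.

Lemma iter_avg_op_tsmooth n a C f D B : tsmooth C f D B ->
  exists D' B', tsmooth C (iter n (avg_op a) f) D' B'.
Proof.
move=> tf; elim: n => [|n [D' [B' ih]]]; first by exists D, B.
by do 2 eexists; exact: avg_op_tsmooth ih.
Qed.

Lemma avg_op_local a C f D B x : 0 <= a -> tsmooth C f D B ->
  (forall i, \sum_r p r * X r ord0 i = 0) ->
  `|avg_op a f x - f x - a ^+ 2 * \sum_r p r * quad B x (X r)|
    <= C * (\sum_r p r * l1 (X r) ^+ 3) * a ^+ 3.
Proof.
move=> a0 [_ _ _ _ f3] EX.
have -> : avg_op a f x - f x - a ^+ 2 * \sum_r p r * quad B x (X r) =
   \sum_r p r * (f (x + a *: X r) - f x - lin D x (a *: X r) - quad B x (a *: X r)).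
  under [RHS]eq_bigr do rewrite !mulrBr.
  rewrite !sumrB avg_cst.
  have -> : \sum_r p r * lin D x (a *: X r) = 0.
    rewrite /lin; under eq_bigr do rewrite mulr_sumr.
    rewrite exchange_big big1// => i _ /=.
    transitivity (a * D i x * \sum_r p r * X r ord0 i); last by rewrite EX mulr0.
    by rewrite mulr_sumr; apply: eq_bigr => r _; rewrite mxE; ring.
  rewrite subr0 mulr_sumr; congr (_ - _); apply: eq_bigr => r _.
  by rewrite quadZ mulrCA.
rewrite (le_trans (ler_norm_sum _ _ _))// mulr_sumr mulr_suml.
apply: ler_sum => r _; rewrite normrM ger0_norm//.
rewrite [leRHS](_ : _ = p r * (C * l1 (a *: X r) ^+ 3)); last first.
  by rewrite l1Z ger0_norm// exprMn; ring.
by rewrite ler_wpM2l// f3.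
Qed.

Lemma gauss_op_local s w C f D B x : 0 < s -> tsmooth C f D B ->
  `|gauss_op s w f x - f x - s ^+ 2 * quad B x w| <= C * (64 * l1 w ^+ 3) * s ^+ 3.
Proof.
move=> s0 tf; have bf := ts_bdlip tf; have C0 := ts_ge0 tf.
case: tf => [_ _ _ _ f3].
have ig := bdlip_line_integrable s x w bf.
have is1 := gauss_int_id s0; have is2 := gauss_int_sqr s0.
have is3 := gauss_int_cube s0.
(* The second-order Taylor remainder along [w]: the moments 0 and [s ^ 2] turn its expectation into
   the left side, and the third absolute moment bounds it. *)
pose F (z : R) := f (x + z *: w) + (- f x + (- lin D x w * z + - quad B x w * z ^+ 2)).
have iF0 : gauss_int s (fun z : R => - lin D x w * z + - quad B x w * z ^+ 2).
  by apply: gauss_intD; exact: gauss_intZ.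
have iF1 : gauss_int s (fun z : R => - f x + (- lin D x w * z + - quad B x w * z ^+ 2)).
  by apply: gauss_intD => //; exact: gauss_int_cst.
have iF : gauss_int s F by exact: gauss_intD.
have -> : gauss_op s w f x - f x - s ^+ 2 * quad B x w = gaussE s F.
  rewrite /F gaussED// gaussED//; last exact: gauss_int_cst.
  rewrite gaussED; [|exact: gauss_intZ|exact: gauss_intZ].
  rewrite gaussE_cst gaussEZ// (gaussEZ _ is2) (gaussE_id s0) (gaussE_sqr s0) /gauss_op; ring.
have -> : C * (64 * l1 w ^+ 3) * s ^+ 3 = C * l1 w ^+ 3 * (64 * s ^+ 3) by ring.
apply: (@le_trans _ _ (gaussE s (fun z => C * l1 w ^+ 3 * `|z| ^+ 3))).
  apply: gaussE_norm_le => //; first exact: gauss_intZ.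
  move=> z; have := f3 x (z *: w); rewrite linZ quadZ l1Z exprMn /F => h.
  rewrite (_ : f _ + _ = f (x + z *: w) - f x - z * lin D x w - z ^+ 2 * quad B x w); last by ring.
  by rewrite (le_trans h)// -mulrA [l1 w ^+ 3 * _]mulrC.
rewrite gaussEZ// ler_wpM2l//; last exact: gaussE_cube.
by rewrite mulr_ge0// exprn_ge0// l1_ge0.
Qed.

(** A crude first-order bound, but it is applied to [a ^ 2 * quads B ws] with a scale proportional
    to [a], where it already has size [a ^ 3]. *)
Lemma gauss_op_lip_dist s w M C g x : 0 < s -> bdlip M C g ->
  `|gauss_op s w g x - g x| <= C * l1 w * s.
Proof.
move=> s0 gb; have ig := bdlip_line_integrable s x w gb.
have -> : gauss_op s w g x - g x = gaussE s (fun z => g (x + z *: w) - g x).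
  by rewrite gaussEB// ?gaussE_cst//; exact: gauss_int_cst.
have C0 : 0 <= C * l1 w.
  case: gb => _ /(_ w 0); rewrite subr0; apply: le_trans; exact: normr_ge0.
apply: (@le_trans _ _ (gaussE s (fun z => C * l1 w * `|z|))).
  apply: gaussE_norm_le.
  - apply: gauss_intD => //; exact: gauss_int_cst.
  - by apply: gauss_intZ; apply: gauss_int_norm => //; exact: gauss_int_id.
  - move=> z; case: gb => _ gC; rewrite (le_trans (gC _ _))//.
    by rewrite addrAC subrr add0r l1Z -mulrA [l1 w * _]mulrC.
rewrite gaussEZ; last by apply: gauss_int_norm => //; exact: gauss_int_id.
by rewrite ler_wpM2l// gaussE_norm_id.
Qed.

(** The generator of the Gaussian semigroup: since [B] is half the Hessian, this is half the trace
    of the Hessian times the covariance of [ws]. *)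
Definition quads B (ws : seq (R * V)) x := \sum_(q <- ws) q.1 ^+ 2 * quad B x q.2.

Lemma quads_bdlip B C (ws : seq (R * V)) : (forall i j, bdlip C C (B i j)) ->
  let L := C * \sum_(q <- ws) q.1 ^+ 2 * l1 q.2 ^+ 2 in bdlip L L (quads B ws).
Proof.
move=> bB /=; elim: ws => [|q ws ih].
  rewrite big_nil mulr0; split=> [x|x y]; rewrite /quads !big_nil ?subrr normr0 ?mul0r//.
have -> : quads B (q :: ws) = (fun x => q.1 ^+ 2 * quad B x q.2 + quads B ws x).
  by apply/funext => x; rewrite /quads big_cons.
rewrite big_cons mulrDr; apply: bdlipD ih.
have := bdlipZ (q.1 ^+ 2) (quad_bdlip q.2 bB).
by rewrite ger0_norm ?sqr_ge0// mulrCA.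
Qed.

(** Three errors of order [a ^ 3] appear when a head factor is added: replacing the tail by its
    expansion under the contracting head, expanding the head at [f], and moving the head past the
    quadratic term. [K] depends on [ws] only, which makes the estimate usable at every iterate. *)
Lemma gauss_ops_local (ws : seq (R * V)) : pos_scales ws ->
  exists2 K, 0 <= K & forall a C f D B, 0 < a -> tsmooth C f D B -> forall x,
  `|gauss_ops a ws f x - f x - a ^+ 2 * quads B ws x| <= C * K * a ^+ 3.
Proof.
elim: ws => [_|q ws ih /= /andP[q0 /ih[K K0 hK]]].
  exists 0 => // a C f D B a0 _ x.
  by rewrite /quads big_nil /= subrr mulr0 subr0 normr0 mulr0 mul0r.
pose S := \sum_(q <- ws) q.1 ^+ 2 * l1 q.2 ^+ 2.
have S0 : 0 <= S by apply: sumr_ge0 => r _; rewrite mulr_ge0 ?sqr_ge0.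
exists (K + (64 * l1 q.2 ^+ 3 * q.1 ^+ 3 + S * l1 q.2 * q.1)).
  by rewrite !addr_ge0// !mulr_ge0// ?exprn_ge0 ?l1_ge0 ?(ltW q0).
move=> a C f D B a0 tf x.
have C0 := ts_ge0 tf; have bf := ts_bdlip tf.
have bQ := quads_bdlip ws (ts_lipB tf); rewrite -/S in bQ.
have bQa := bdlipZ (a ^+ 2) bQ.
have bG := bdlipD bf bQa.
have aq : 0 < a * q.1 by rewrite mulr_gt0.
have e1 : `|gauss_op (a * q.1) q.2 (gauss_ops a ws f) x -
    gauss_op (a * q.1) q.2 (fun y => f y + a ^+ 2 * quads B ws y) x| <= C * K * a ^+ 3.
  apply: (gauss_op_contract _ _ (gauss_ops_bdlip a ws bf) bG) => y.
  by rewrite opprD addrA; exact: hK tf y.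
rewrite (gauss_opD _ _ bf bQa) (gauss_opZ _ _ _ bQ) in e1.
have e2 := gauss_op_local q.2 x aq tf.
have e3 := gauss_op_lip_dist q.2 x aq bQ.
have e4 : `|a ^+ 2 * (gauss_op (a * q.1) q.2 (quads B ws) x - quads B ws x)| <=
   a ^+ 2 * (C * S * l1 q.2 * (a * q.1)).
  by rewrite normrM (ger0_norm (sqr_ge0 a)) ler_wpM2l// sqr_ge0.
have -> : quads B (q :: ws) x = q.1 ^+ 2 * quad B x q.2 + quads B ws x.
  by rewrite /quads big_cons.
set P := gauss_op _ _ (gauss_ops a ws f) x in e1 *.
set G := gauss_op _ _ f x in e1 e2.
set Q := gauss_op _ _ (quads B ws) x in e1 e4.
have -> : P - f x - a ^+ 2 * (q.1 ^+ 2 * quad B x q.2 + quads B ws x) =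
  (P - (G + a ^+ 2 * Q)) + ((G - f x - (a * q.1) ^+ 2 * quad B x q.2) +
   a ^+ 2 * (Q - quads B ws x)) by ring.
have -> : C * (K + (64 * l1 q.2 ^+ 3 * q.1 ^+ 3 + S * l1 q.2 * q.1)) * a ^+ 3 =
  C * K * a ^+ 3 + (C * (64 * l1 q.2 ^+ 3) * (a * q.1) ^+ 3 +
   a ^+ 2 * (C * S * l1 q.2 * (a * q.1))) by ring.
rewrite (le_trans (ler_normD _ _))// lerD//.
by rewrite (le_trans (ler_normD _ _))// lerD.
Qed.

(** With [A] the average and [G] the Gaussian operator, [A^(n+1) f - G^(n+1) f = (A - G) A^n f + G
    (A^n f - G^n f)]. The hypothesis handles the first term and contraction the second, so
    smoothness is asked of [A^n f] alone. *)
Lemma trotter_dist (ws : seq (R * V)) a C e n :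
  (forall f D B, tsmooth C f D B -> forall x, `|avg_op a f x - gauss_ops a ws f x| <= e) ->
  forall f D B, tsmooth C f D B -> forall x,
  `|iter n (avg_op a) f x - iter n (gauss_ops a ws) f x| <= n%:R * e.
Proof.
move=> loc f D B tf; elim: n => [|n ih] x; first by rewrite /= subrr normr0 mul0r.
have [D' [B' tn]] := iter_avg_op_tsmooth n a tf.
have bV : bdlip C C (iter n (gauss_ops a ws) f).
  by elim: n {ih tn} => [|n ihn] /=; [exact: ts_bdlip tf|exact: gauss_ops_bdlip].
rewrite !iterS.
set g := iter n (avg_op a) f in ih tn *; set h := iter n (gauss_ops a ws) f in ih bV *.
have -> : avg_op a g x - gauss_ops a ws h x =
  (avg_op a g x - gauss_ops a ws g x) + (gauss_ops a ws g x - gauss_ops a ws h x) by ring.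
rewrite -nat1r mulrDl mul1r (le_trans (ler_normD _ _))// lerD//; first exact: loc tn x.
exact: gauss_ops_contract (ts_bdlip tn) bV ih x.
Qed.

Hypothesis X_mean : forall i, \sum_r p r * X r ord0 i = 0.
Variable ws : seq (R * V).
Hypothesis ws_pos : pos_scales ws.
Hypothesis ws_cov : forall i j, \sum_r p r * (X r ord0 i * X r ord0 j) =
  \sum_(q <- ws) q.1 ^+ 2 * (q.2 ord0 i * q.2 ord0 j).

Lemma quads_cov B x : \sum_r p r * quad B x (X r) = quads B ws x.
Proof.
rewrite /quads /quad.
under eq_bigr do rewrite mulr_sumr.
under [RHS]eq_bigr do rewrite mulr_sumr.
rewrite exchange_big [RHS]exchange_big; apply: eq_bigr => i _ /=.
under eq_bigr do rewrite mulr_sumr.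
under [RHS]eq_bigr do rewrite mulr_sumr.
rewrite exchange_big [RHS]exchange_big; apply: eq_bigr => j _ /=.
under eq_bigr do rewrite mulrCA.
under [RHS]eq_bigr do rewrite mulrCA.
by rewrite -!mulr_sumr ws_cov.
Qed.

Lemma clt_smooth C f D B x : tsmooth C f D B ->
  iter n.+1 (avg_op (Num.sqrt n.+1%:R)^-1) f x @[n --> \oo] --> gauss_ops 1 ws f x.
Proof.
move=> tf; have C0 := ts_ge0 tf.
have [K K0 hK] := gauss_ops_local ws_pos.
pose L := \sum_r p r * l1 (X r) ^+ 3.
have L0 : 0 <= L by apply: sumr_ge0 => r _; rewrite mulr_ge0// exprn_ge0// l1_ge0.
pose E := C * L + C * K.
have E0 : 0 <= E by rewrite addr_ge0// mulr_ge0.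
have bound n : `|iter n.+1 (avg_op (Num.sqrt n.+1%:R)^-1) f x - gauss_ops 1 ws f x| <=
    E * (Num.sqrt n.+1%:R)^-1.
  set a := (Num.sqrt _)^-1.
  have a0 : 0 < a by rewrite invr_gt0 sqrtr_gt0.
  have na : n.+1%:R * a ^+ 2 = 1 ^+ 2.
    by rewrite /a exprVn sqr_sqrtr// expr1n mulfV.
  rewrite -(iter_gauss_ops a0 ltr01 na ws_pos (ts_bdlip tf) C0).
  (* Since [n.+1 * a ^ 2 = 1], the sum of [n.+1] errors of size [E * a ^ 3] is [E * a]. *)
  have -> : E * a = n.+1%:R * (E * a ^+ 3).
    rewrite [RHS](_ : _ = E * a * (n.+1%:R * a ^+ 2)); last by ring.
    by rewrite na expr1n mulr1.
  apply: trotter_dist tf x => g D' B' tg x.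
  have h1 := avg_op_local x (ltW a0) tg X_mean.
  have h2 := hK a C g D' B' a0 tg x.
  rewrite quads_cov in h1.
  rewrite (_ : _ - _ = (avg_op a g x - g x - a ^+ 2 * quads B' ws x) -
    (gauss_ops a ws g x - g x - a ^+ 2 * quads B' ws x)); last by ring.
  by rewrite (le_trans (ler_normB _ _))// mulrDl lerD.
apply/cvgrPdist_le => /= e e0.
pose N := Num.truncn ((E / e) ^+ 2).
near=> n.
rewrite distrC (le_trans (bound n))// ler_pdivrMr ?sqrtr_gt0//.
rewrite mulrC -ler_pdivrMr//.
rewrite -[leLHS]ger0_norm; last by rewrite divr_ge0// ltW.
rewrite -sqrtr_sqr ler_wsqrtr//.
have : (N <= n)%N by near: n; exact: nbhs_infty_ge.
rewrite -(ler_nat R) => h; rewrite -nat1r.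
have := truncnS_gt ((E / e) ^+ 2); rewrite -/N -nat1r => /ltW h'.
by rewrite (le_trans h')// lerD2l.
Unshelve. all: by end_near. Qed.

End Trotter.

(** * Schur complements and Cholesky vectors *)

Section Schur.
Variable R : realType.

Definition posdef k (H : 'M[R]_k) :=
  H^T = H /\ forall u : 'rV[R]_k, u != 0 -> 0 < (u *m H *m u^T) ord0 ord0.

Variable k : nat.
Implicit Type H : 'M[R]_(1 + k).

Definition pivot H : R := H ord0 ord0.
(** For a covariance [H], [prow H] holds the regression coefficients of the other coordinates on the
    first, and [schur H] is their conditional covariance. *)
Definition prow H : 'rV[R]_k := (pivot H)^-1 *: ursubmx H.
Definition schur H : 'M[R]_k := drsubmx H - pivot H *: ((prow H)^T *m prow H).

Definition elim_mx H : 'M[R]_(1 + k) := block_mx 1%:M 0 (- (prow H)^T) 1%:M.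

Lemma ulsubmx_pivot H : ulsubmx H = (pivot H)%:M.
Proof.
apply/matrixP => i j; rewrite !ord1 !mxE eqxx mulr1n /pivot.
by congr (H _ _); apply/val_inj.
Qed.

Lemma schur_elim H : H^T = H -> pivot H != 0 ->
  elim_mx H *m H *m (elim_mx H)^T = block_mx (pivot H)%:M 0 0 (schur H).
Proof.
move=> HT h0.
have bE : ursubmx H = pivot H *: prow H by rewrite /prow scalerA mulfV// scale1r.
have cE : dlsubmx H = pivot H *: (prow H)^T.
  by rewrite -[in LHS]HT -trmx_ursub bE linearZ.
rewrite -{2}[H]submxK ulsubmx_pivot bE cE /elim_mx tr_block_mx mulmx_block.
rewrite !trmx1 !trmx0 linearN/= trmxK mulmx_block.
rewrite !mul1mx !mulmx1 !mul0mx !mulmx0 !addr0.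
rewrite mulmxN mul_scalar_mx addNr mul_mx_scalar scalerN addNr mul0mx add0r.
by rewrite mulNmx -scalemxAr /schur addrC.
Qed.

Lemma det_elim H : \det (elim_mx H) = 1.
Proof. by rewrite det_lblock !det1 mulr1. Qed.

Lemma posdef_pivot H : posdef H -> 0 < pivot H.
Proof.
pose e : 'rV[R]_(1 + k) := delta_mx ord0 ord0.
case=> _ /(_ e); rewrite {2}/e -rowE.
have -> : (row ord0 H *m e^T) ord0 ord0 = pivot H.
  by rewrite /e trmx_delta -colE !mxE.
apply; rewrite /e; apply/eqP => /matrixP /(_ ord0 ord0); rewrite !mxE !eqxx/=.
by move/eqP; rewrite oner_eq0.
Qed.

Lemma mulmx_row0 (A : 'M[R]_1) (B : 'M[R]_(1, k)) (D : 'M[R]_k) (v : 'rV[R]_k) :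
  row_mx 0 v *m block_mx A B 0 D = row_mx 0 (v *m D).
Proof. by rewrite mul_row_block !mul0mx mulmx0 !add0r. Qed.

(** The form of [schur H] at [v] equals that of [H] at [row_mx 0 v *m elim_mx H], a nonzero vector
    because [elim_mx H] is invertible. *)
Lemma posdef_schur H : posdef H -> posdef (schur H).
Proof.
move=> pH; have h0 := posdef_pivot pH; case: pH => HT Hpos.
split.
  rewrite /schur linearB/= linearZ/= trmx_mul trmxK; congr (_ - _).
  by rewrite trmx_drsub HT.
move=> v v0; set P := elim_mx H.
have := Hpos (row_mx 0 v *m P).
rewrite trmx_mul !mulmxA -(mulmxA _ P H) -(mulmxA _ (P *m H)).
rewrite schur_elim ?gt_eqF// mulmx_row0.
have -> : row_mx 0 (v *m schur H) *m (row_mx (0 : 'M[R]_1) v)^T =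
    v *m schur H *m v^T.
  by rewrite tr_row_mx mul_row_col mul0mx add0r.
apply.
apply/eqP => e; case/eqP: v0.
have : row_mx 0 v *m P *m invmx P = 0 by rewrite e mul0mx.
rewrite mulmxK; last by rewrite unitmxE det_elim unitr1.
by move/(congr1 rsubmx); rewrite row_mxKr linear0.
Qed.

Lemma det_schur H : posdef H -> \det H = pivot H * \det (schur H).
Proof.
move=> pH; have h0 := posdef_pivot pH; case: (pH) => HT _.
have := congr1 determinant (schur_elim HT (lt0r_neq0 h0)).
by rewrite !det_mulmx det_tr det_elim mul1r mulr1 det_ublock det_scalar1.
Qed.

(** The exponent of the Gaussian density splits into that of the first coordinate and that of the
    others given the first, whose conditional mean is [y *: prow H]. *)
Lemma quad_schur H (y : R) (v : 'rV[R]_k) : posdef H -> schur H \in unitmx ->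
  let u := row_mx y%:M v in
  (u *m invmx H *m u^T) ord0 ord0 = y ^+ 2 / pivot H +
   ((v - y *: prow H) *m invmx (schur H) *m (v - y *: prow H)^T) ord0 ord0.
Proof.
move=> pH Su u; have h0 := posdef_pivot pH; case: (pH) => HT _.
have e := schur_elim HT (lt0r_neq0 h0).
set P := elim_mx H in e.
pose Dinv : 'M[R]_(1 + k) := block_mx (pivot H)^-1%:M 0 0 (invmx (schur H)).
have DD : Dinv *m block_mx (pivot H)%:M 0 0 (schur H) = 1%:M.
  rewrite mulmx_block !mulmx0 !mul0mx !addr0 !add0r mulVmx// -scalar_mxM.
  by rewrite mulVf ?gt_eqF// -scalar_mx_block.
rewrite -e !mulmxA in DD.
have HE := mulmx1C DD; rewrite !mulmxA in HE.
have -> : invmx H = P^T *m Dinv *m P.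
  have [_ Hu] := mulmx1_unit HE.
  by rewrite -[RHS]mulmx1 -(mulmxV Hu) mulmxA HE mul1mx.
have uP : u *m P^T = row_mx y%:M (v - y *: prow H).
  rewrite /u /P /elim_mx tr_block_mx mul_row_block !trmx1 !trmx0 linearN/= trmxK.
  by rewrite !mulmx1 mulmx0 addr0 mulmxN mul_scalar_mx addrC.
have -> : u *m (P^T *m Dinv *m P) *m u^T = (u *m P^T) *m Dinv *m (u *m P^T)^T.
  by rewrite trmx_mul trmxK !mulmxA.
rewrite uP mul_row_block !mulmx0 addr0 add0r tr_row_mx mul_row_col mxE.
congr (_ + _); rewrite tr_scalar_mx -!scalar_mxM mxE eqxx mulr1n.
by rewrite expr2 mulrAC.
Qed.

Lemma row_mx_cov H (i j : 'I_(1 + k)) (ws : seq (R * 'rV[R]_k)) :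
  H^T = H -> pivot H != 0 ->
  (forall i j, \sum_(q <- ws) q.1 ^+ 2 * (q.2 ord0 i * q.2 ord0 j) = schur H i j) ->
  pivot H * (row_mx 1%:M (prow H) ord0 i * row_mx 1%:M (prow H) ord0 j) +
  \sum_(q <- ws) q.1 ^+ 2 *
    (row_mx (0 : 'M[R]_1) q.2 ord0 i * row_mx (0 : 'M[R]_1) q.2 ord0 j) = H i j.
Proof.
move=> HT h0' wsS.
have symH a b : H a b = H b a by rewrite -{1}HT mxE.
rewrite -[i]splitK -[j]splitK.
case: (fintype.split i) => i'; case: (fintype.split j) => j' /=.
- rewrite !row_mxEl !ord1 !mxE eqxx !mulr1 big1 ?addr0; last first.
    by move=> q _; rewrite !row_mxEl !mxE !mul0r mulr0.
  by rewrite /pivot; congr (H _ _); apply/val_inj.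
- rewrite row_mxEl row_mxEr !ord1 [1%:M _ _]mxE eqxx mulr1n mul1r big1 ?addr0; last first.
    by move=> q _; rewrite row_mxEl mxE mul0r mulr0.
  rewrite mxE mulrA mulfV// mul1r mxE mxE /=.
  by congr (H _ _); apply/val_inj.
- rewrite row_mxEl row_mxEr !ord1 [1%:M _ _]mxE eqxx mulr1n mulr1 big1 ?addr0; last first.
    by move=> q _; rewrite row_mxEl [X in _ * (_ * X)]mxE !mulr0.
  rewrite mxE mulrA mulfV// mul1r mxE mxE /= symH.
  by congr (H _ _); apply/val_inj.
- rewrite !row_mxEr.
  under eq_bigr do rewrite !row_mxEr.
  by rewrite wsS /schur !mxE big_ord1 !mxE; ring.
Qed.

End Schur.

Section Cholesky.
Variable R : realType.

(** The factors of an LDL decomposition, with the scale kept apart from the direction. The leading 1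
    of each direction means that a displacement by [z] moves the coordinate being eliminated by
    exactly [z]. *)
Fixpoint chol k : 'M[R]_k -> seq (R * 'rV[R]_k) :=
  match k with
  | 0 => fun _ => [::]
  | k'.+1 => fun H : 'M[R]_(1 + k') =>
      (Num.sqrt (pivot H), row_mx 1%:M (prow H)) ::
      [seq (q.1, row_mx 0 q.2) | q <- chol (schur H)]
  end.

Lemma posdef_det k (H : 'M[R]_k) : posdef H -> 0 < \det H.
Proof.
elim: k H => [|k ih] H pH; first by rewrite det_mx00.
rewrite (@det_schur _ k)// mulr_gt0//; first exact: posdef_pivot.
exact/ih/posdef_schur.
Qed.

Lemma posdef_unit k (H : 'M[R]_k) : posdef H -> H \in unitmx.
Proof. by move=> /posdef_det h; rewrite unitmxE unitfE gt_eqF. Qed.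

Lemma chol_pos k (H : 'M[R]_k) : posdef H -> pos_scales (chol H).
Proof.
elim: k H => [//|k ih] H pH /=; rewrite sqrtr_gt0 (@posdef_pivot _ k)//=.
rewrite /pos_scales all_map; exact/ih/(@posdef_schur _ k).
Qed.

Lemma chol_cov k (H : 'M[R]_k) i j : posdef H ->
  \sum_(q <- chol H) q.1 ^+ 2 * (q.2 ord0 i * q.2 ord0 j) = H i j.
Proof.
elim: k H i j => [H []//|k ih] H i j pH /=.
have h0 := @posdef_pivot _ k H pH.
have h0' : pivot H != 0 by rewrite gt_eqF.
rewrite big_cons big_map /= sqr_sqrtr ?(ltW h0)//.
case: pH (@posdef_schur _ k H pH) => HT _ pS.
by apply: (@row_mx_cov _ k) => // i' j'; exact: ih.
Qed.

End Cholesky.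

(** * From the Gaussian operators to the orthant integral *)

Section OrthantLimit.
Variable R : realType.
Notation mu := (@lebesgue_measure R).
Implicit Types (y M C t : R).

(** The vector built inside [orthant_integral], so that its body can be folded into [prep]. *)
Definition prep k y (v : 'rV[R]_k) : 'rV[R]_k.+1 :=
  \row_(i < k.+1) (if unlift ord0 i is Some j then v ord0 j else y).

Lemma prepE k y (v : 'rV[R]_k) : prep y v = row_mx (y%:M : 'M[R]_1) v.
Proof.
apply/rowP => i; rewrite !mxE.
case: unliftP => [j ->|->].
  case: fintype.splitP => [i' /=|i' /= e]; first by rewrite ord1.
  by congr (v _ _); apply/val_inj; case: e.
case: fintype.splitP => [i' /= _|i' /=]; last by [].
by rewrite !mxE !ord1 eqxx mulr1n.
Qed.

Lemma prepDZ k y (v b : 'rV[R]_k) a :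
  prep y v + a *: row_mx (1%:M : 'M[R]_1) b = prep (y + a) (v + a *: b).
Proof.
rewrite !prepE; have := @add_row_mx R 1 1 k y%:M v (a *: 1%:M) (a *: b).
by rewrite -scale_row_mx scalemx1 -raddfD.
Qed.

Lemma prepB k y y' (v v' : 'rV[R]_k) :
  prep y v - prep y' v' = row_mx ((y - y')%:M : 'M[R]_1) (v - v').
Proof.
rewrite !prepE; have := @add_row_mx R 1 1 k y%:M v (- y'%:M) (- v').
by rewrite -opp_row_mx -raddfB.
Qed.

Lemma orthant_integral_ge0 k (f : 'rV[R]_k -> \bar R) :
  (forall u, 0 <= f u)%E -> (0 <= orthant_integral f)%E.
Proof.
elim: k f => [|k ih] f f0 /=; first exact: f0.
by apply: integral_ge0 => x _; apply: ih => v; exact: f0.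
Qed.

Lemma orthant_integral0 k : orthant_integral (fun _ : 'rV[R]_k => 0%E) = 0%E.
Proof.
elim: k => [//|k ih] /=.
by under eq_integral do rewrite ih; exact: integral0.
Qed.

Lemma eq_orthant_integral k (f g : 'rV[R]_k -> \bar R) :
  (forall u, f u = g u) -> orthant_integral f = orthant_integral g.
Proof. by move=> fg; congr orthant_integral; apply/funext. Qed.

Lemma gauss_ops_ge0 k a ws (h : 'rV[R]_k -> R) :
  (forall x, 0 <= h x) -> forall x, 0 <= gauss_ops a ws h x.
Proof.
move=> h0; elim: ws => [//|q ws ih] x /=.
by apply: Rintegral_ge0 => z _; rewrite mulr_ge0 ?normal_pdf_ge0.
Qed.

Lemma gauss_ops_row_mx k a (ws : seq (R * 'rV[R]_k)) (f : 'rV[R]_(1 + k) -> R)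
    (c : 'M[R]_1) (v : 'rV[R]_k) :
  gauss_ops a [seq (q.1, row_mx (0 : 'M[R]_1) q.2) | q <- ws] f (row_mx c v) =
  gauss_ops a ws (fun v => f (row_mx c v)) v.
Proof.
elim: ws v => [//|q ws ih] v /=; rewrite /gauss_op; congr gaussE; apply/funext => z.
by rewrite scale_row_mx scaler0 add_row_mx addr0 ih.
Qed.

Lemma bdlip_prep k M C (f : 'rV[R]_(1 + k) -> R) (c : 'M[R]_1) :
  bdlip M C f -> bdlip M C (fun v : 'rV[R]_k => f (row_mx c v)).
Proof.
case=> fM fC; split=> // x y; rewrite (le_trans (fC _ _))//.
rewrite opp_row_mx add_row_mx subrr.
have -> : l1 (row_mx (0 : 'M[R]_1) (x - y)) = l1 (x - y).
  rewrite /l1 big_split_ord /= big_ord1 row_mxEl mxE normr0 add0r.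
  by apply: eq_bigr => i _; rewrite row_mxEr.
by [].
Qed.

Definition gauss_const k (H : 'M[R]_k) : R := (Num.sqrt ((2 * pi) ^+ k * \det H))^-1.

Definition qform k (H : 'M[R]_k) (u : 'rV[R]_k) : R := (u *m invmx H *m u^T) ord0 ord0.

(* In the induction the weight [t] absorbs the Gaussian density of the outermost
   coordinate; it is set to 0 when that coordinate is negative. *)
Lemma gauss_ops_orthant k (H : 'M[R]_k) (F : nat -> 'rV[R]_k -> R) t (x0 : 'rV[R]_k) M :
  posdef H -> 0 <= t ->
  (forall n, exists C, bdlip M C (F n)) -> (forall n u, 0 <= F n u) ->
  (forall u : 'rV[R]_k, (forall j, u ord0 j != 0) ->
     F n u @[n --> \oo] --> t * [forall j, 0 < u ord0 j]%:R) ->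
  (gauss_ops 1 (chol H) (F n) x0)%:E @[n --> \oo] -->
  ((gauss_const H)%:E *
   orthant_integral (fun u : 'rV[R]_k => (t * expR (- qform H (u - x0) / 2))%:E))%E.
Proof.
elim: k H F t x0 M => [|k ih] H F t x0 M pH t0 Fbl F0 Flim.
  rewrite /= /gauss_const det_mx00 expr0 mulr1 sqrtr1 invr1 mul1e.
  rewrite /qform [in - _](_ : _ ord0 ord0 = 0); last by rewrite mxE big_ord0.
  rewrite oppr0 mul0r expR0 mulr1.
  have := Flim x0; rewrite (_ : [forall j, _] = true); last by apply/forallP; case.
  rewrite mulr1 => h; apply: cvg_EFin; first by apply: nearW.
  by apply: h; case.
have h0 : 0 < pivot (H : 'M[R]_(1 + k)) := @posdef_pivot _ k H pH.
set h := pivot (H : 'M[R]_(1 + k)) in h0.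
have pS := @posdef_schur _ k H pH; set S := schur (H : 'M[R]_(1 + k)) in pS.
pose y0 := x0 ord0 ord0.
pose v0 : 'rV[R]_k := rsubmx (x0 : 'rV[R]_(1 + k)).
have x0E : x0 = prep y0 v0.
  apply/rowP => i; rewrite mxE; case: unliftP => [j ->|-> //].
  by rewrite mxE; congr (x0 _ _); apply/val_inj.
pose b := prow (H : 'M[R]_(1 + k)).
(* The conditional mean of the remaining coordinates when the first one equals [y]. *)
pose vy y := v0 + (y - y0) *: b.
pose s := Num.sqrt h.
have s0 : 0 < s by rewrite sqrtr_gt0.
have s2 : s ^+ 2 = h by rewrite sqr_sqrtr// ltW.
pose w : 'rV[R]_k.+1 := row_mx (1%:M : 'M[R]_1) b.
have lineE y : x0 + (y - y0) *: w = prep y (vy y).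
  by rewrite [X in X + _]x0E prepDZ subrKC.
pose Pn n (v : 'rV[R]_k.+1) :=
  gauss_ops 1 [seq (q.1, row_mx (0 : 'M[R]_1) q.2) | q <- chol S] (F n) v.
have PnE n y v : Pn n (prep y v) = gauss_ops 1 (chol S) (fun v => F n (prep y v)) v.
  rewrite /Pn prepE gauss_ops_row_mx; congr gauss_ops.
  by apply/funext => v'; rewrite prepE.
have PnB n : exists C, bdlip M C (Pn n).
  by have [C bC] := Fbl n; exists C; exact: gauss_ops_bdlip.
have Pn0 n v : 0 <= Pn n v by exact: gauss_ops_ge0.
(* The head Gaussian integrand after a translation: [y] is now the first coordinate itself, like the
   outer variable of [orthant_integral]. *)
pose J n y := normal_pdf 0 s (y - y0) * Pn n (x0 + (y - y0) *: w).
have J0 n y : 0 <= J n y by rewrite mulr_ge0 ?normal_pdf_ge0.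
have cline n : continuous (fun z : R => Pn n (x0 + z *: w)).
  have [C bC] := PnB n.
  exact: lipschitz1_continuous (bdlip_line x0 w bC).
have csub : continuous (fun y : R => y - y0).
  by move=> y; apply: (@cvgB _ R^o); [exact: cvg_id|exact: cvg_cst].
have cpdf : continuous (normal_pdf 0 s) by apply: continuous_normal_pdf; rewrite gt_eqF.
have cJ n : continuous (J n).
  move=> y; apply: cvgM.
    apply: (@continuous_comp _ _ _ (fun z => z - y0) (normal_pdf 0 s)).
      exact: csub.
    exact: cpdf.
  apply: (@continuous_comp _ _ _ (fun z => z - y0) (fun z => Pn n (x0 + z *: w))).
    exact: csub.
  exact: cline.
have mJ n : measurable_fun setT (EFin \o J n).
  by apply/measurable_EFinP; exact: continuous_measurable_fun.
have gauss_opsE n : (gauss_ops 1 (chol H) (F n) x0)%:E = (\int[mu]_y (J n y)%:E)%E.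
  have [C bC] := PnB n.
  rewrite /= -/(Pn n) mul1r -/s -/w /gauss_op /gaussE /Rintegral fineK; last first.
    by apply: integrable_fin_num => //; exact: bdlip_line_integrable bC.
  rewrite (integral_shift (- y0))//.
  - by move=> y; apply: cvgM; [exact: cpdf|exact: cline].
  - by move=> y; apply: mulr_ge0; [exact: normal_pdf_ge0|exact: Pn0].
pose e y := expR (- (y - y0) ^+ 2 / (h *+ 2)).
pose ty y := e y * (t * (0 < y)%R%:R).
pose c := normal_peak s * gauss_const S.
have cS0 : 0 < gauss_const S.
  by rewrite invr_gt0 sqrtr_gt0 mulr_gt0 ?posdef_det// exprn_gt0// mulr_gt0// pi_gt0.
have c0 : 0 < c by rewrite mulr_gt0// normal_peak_gt0// gt_eqF.
pose O y := orthant_integral (fun v : 'rV[R]_k =>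
   (ty y * expR (- qform S (v - vy y) / 2))%:E).
pose L y := (c%:E * O y)%E.
(* [Flim] is silent on the coordinate hyperplanes, so [y = 0] is left out; it is a null set. The
   induction hypothesis is used with [e y] moved into the test function, which gives the weight
   [ty y]. *)
have Jlim y : y != 0 -> (J n y)%:E @[n --> \oo] --> L y.
  move=> yn0.
  pose G n (v : 'rV[R]_k) := e y * F n (prep y v).
  have e_ge0 : 0 <= e y by exact: expR_ge0.
  have GE n : (J n y)%:E = ((normal_peak s)%:E * (gauss_ops 1 (chol S) (G n) (vy y))%:E)%E.
    have [C bC] := Fbl n.
    have bC' : bdlip M C (fun v => F n (prep y v)).
      have := bdlip_prep y%:M bC; congr bdlip; apply/funext => v; by rewrite prepE.
    rewrite /G (gauss_opsZ _ _ _ bC') /J lineE PnE normal_pdf_exp// subr0 s2 -EFinM.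
    by rewrite mulrA.
  under eq_fun do rewrite GE.
  rewrite /L /c EFinM -muleA; apply: cvgeZl => //.
  apply: (ih S G (ty y) (vy y) (e y * M)) => //.
  - by rewrite !mulr_ge0// ler0n.
  - move=> n; have [C bC] := Fbl n; exists (e y * C).
    have := bdlipZ (e y) (bdlip_prep (y%:M : 'M[R]_1) bC); rewrite ger0_norm//.
    by congr bdlip; apply/funext => v; rewrite /G prepE.
  - by move=> n u; rewrite mulr_ge0.
  - move=> u un0; rewrite /ty -mulrA; apply: cvgMr.
    have -> : t * (0 < y)%R%:R * [forall j, 0 < u ord0 j]%:R =
       t * [forall j, 0 < (prep y u) ord0 j]%:R.
      rewrite -mulrA -natrM mulnb; congr (t * _%:R); congr nat_of_bool.
      apply/andP/forallP => [[yp /forallP up] j|up].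
        by rewrite mxE; case: unliftP => [j' _|_].
      split; first by have := up ord0; rewrite mxE unlift_none.
      by apply/forallP => j; have := up (lift ord0 j); rewrite mxE liftK.
    apply: Flim => j; rewrite mxE; case: unliftP => [j' _|_] //; exact: un0.
have O_le0 y : y <= 0 -> O y = 0%E.
  move=> y_le0; rewrite /O -(orthant_integral0 k); apply: eq_orthant_integral => u.
  by rewrite /ty ltNge y_le0 !mulr0 mul0r.
have L_le0 y : y <= 0 -> L y = 0%E by move=> /O_le0 Oy; rewrite /L Oy mule0.
have mL : measurable_fun setT L.
  (* [L] is the pointwise limit of the continuous [J n] away from 0; the indicator makes the
     sequence vanish at 0, where [L] does too. *)
  apply: (@emeasurable_fun_cvg _ _ _ setT (fun n y => (J n y * \1_(~` [set 0]) y)%:E)).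
    move=> n; apply/measurable_EFinP; apply: measurable_funM.
      exact: continuous_measurable_fun.
    by apply: measurable_indic; exact: measurableC.
  move=> y _; have [->|yn0] := eqVneq y 0.
    rewrite L_le0// indicE (_ : _ \in _ = false).
      by under eq_fun do rewrite mulr0; exact: cvg_cst.
    by apply/negbTE; rewrite notin_setE /= => /(_ erefl).
  rewrite indicE (_ : _ \in _ = true).
    by under eq_fun do rewrite mulr1; exact: Jlim.
  by apply/mem_set; exact/eqP.
have M0 : 0 <= M by have [C [+ _]] := Fbl 0%N => /(_ 0); apply: le_trans.
have Jint : (\int[mu]_y (J n y)%:E)%E @[n --> \oo] --> (\int[mu]_y L y)%E.
  pose g y := ((normal_pdf y0 s y * M)%:E : \bar R).
  have [] // := @dominated_convergence _ _ R mu setT measurableT (fun n y => (J n y)%:E) L g mJ mL.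
  - exists [set 0]; split => //; first exact: lebesgue_measure_set1.
    move=> y /= hy; apply/eqP/negP => /negP yn0; apply: hy => _; exact: Jlim.
  - rewrite /g; under eq_fun do rewrite mulrC EFinM.
    by apply: integrableZl => //; exact: integrable_normal_pdf.
  - apply: aeW => y n _; rewrite lee_fin ger0_norm// /J.
    have [C [PM _]] := PnB n.
    have -> : normal_pdf 0 s (y - y0) = normal_pdf y0 s y.
      by rewrite !normal_pdf_exp// subr0.
    by rewrite ler_wpM2l ?normal_pdf_ge0// (le_trans (ler_norm _)).
under eq_fun do rewrite gauss_opsE.
suff -> : ((gauss_const H)%:E * orthant_integral (fun u => (t * expR (- qform H (u - x0) / 2))%:E) =
   \int[mu]_y L y)%E by exact: Jint.
have cE : gauss_const H = c.
  rewrite /c /gauss_const /normal_peak s2 (@det_schur _ k)// -/h -/S -invfM.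
  rewrite -sqrtrM; last by rewrite mulrn_wge0// mulr_ge0 ?pi_ge0// ltW.
  have detE : (2 * pi) ^+ k.+1 * (h * \det S) =
      h * pi *+ 2 * ((2 * pi) ^+ k * \det S) :> R by rewrite exprS; ring.
  by rewrite detE.
have -> : (\int[mu]_y L y = \int[mu]_(y in `]0%R, +oo[) L y)%E.
  rewrite [RHS]integral_mkcond; apply: eq_integral => y _.
  rewrite patchE; case: ifPn => //; rewrite notin_setE /= in_itv/= andbT => /negP.
  by rewrite -leNgt => /L_le0.
have mO : measurable_fun (`]0%R, +oo[ : set R) O.
  have -> : O = (fun y => (c^-1%:E * L y)%E).
    by apply/funext => y; rewrite /L muleA -EFinM mulVf ?gt_eqF// mul1e.
  by apply: measurable_funeM; apply: measurable_funTS.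
transitivity (c%:E * \int[mu]_(y in `]0%R, +oo[) O y)%E; last first.
  apply/esym; apply: ge0_integralZl; [by []|exact: mO| |by rewrite lee_fin ltW].
  move=> y _; apply: orthant_integral_ge0 => u.
  by rewrite lee_fin /ty !mulr_ge0 ?expR_ge0 ?ler0n.
rewrite cE; apply: (congr1 (fun z => c%:E * z)%E).
apply: eq_integral => y; rewrite inE/= in_itv/= andbT => yp.
apply: eq_orthant_integral => v.
rewrite -/(prep y v) /ty yp mulr1 [e y * t]mulrC -mulrA; congr (t * _)%:E.
rewrite /e -expRD; congr expR.
have -> : prep y v - x0 = row_mx ((y - y0)%:M : 'M[R]_1) (v - v0).
  by rewrite [X in _ - X]x0E prepB.
rewrite /qform (@quad_schur _ k)//; last exact: posdef_unit.
have vE : v - vy y = v - v0 - (y - y0) *: b by rewrite /vy opprD addrA.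
rewrite vE -/h -/S -/b.
set Q := (_ *m _ *m _) ord0 ord0.
by field; rewrite gt_eqF.
Qed.

End OrthantLimit.

(** * Derivatives of the cumulant generating function *)

Lemma is_derive_bigsum (R : realType) (I : Type) (s : seq I) (F : I -> R -> R)
    (F' : I -> R) (x : R) :
  (forall i, is_derive x (1 : R) (F i) (F' i)) ->
  is_derive x (1 : R) (fun h => \sum_(i <- s) F i h) (\sum_(i <- s) F' i).
Proof.
move=> dF; elim: s => [|i s ih].
  rewrite big_nil (_ : (fun h => _) = cst 0); first exact: is_derive_cst.
  by apply/funext => h; rewrite big_nil.
rewrite big_cons (_ : (fun h => _) = F i \+ (fun h => \sum_(i <- s) F i h)).
  exact: is_deriveD.
by apply/funext => h; rewrite big_cons.
Qed.

Lemma derive_line (R : realType) k (f : 'rV[R]_k -> R) (a v : 'rV[R]_k) (d : R) :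
  is_derive (0 : R) (1 : R) (fun h : R => f (a + h *: v)) d -> derive f a v = d.
Proof.
case=> _ <-.
have E : (fun h : R => h^-1 *: ((f \o shift a) (h *: v) - f a)) =
    (fun h : R => h^-1 *: (((fun h : R => f (a + h *: v)) \o shift 0) (h *: 1) -
      f (a + 0 *: v))).
  apply/funext => h /=.
  by rewrite addr0 scale0r addr0 [h *: v + a]addrC [h *: 1]mulr1.
by rewrite /derive E.
Qed.

Section Cumulants.
Variables (R : realType) (k : nat) (p : ranking k -> R).
Hypothesis p_pos : forall r, 0 < p r.
Hypothesis p_sum : \sum_(r : ranking k) p r = 1.
Implicit Types (b v : 'rV[R]_k) (i j : 'I_k) (r : ranking k).

Definition adv_ind r j : R := (j \in advs_above r)%:R.
Definition adv_sum r b : R := \sum_j adv_ind r j * b ord0 j.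
Definition mgf b : R := \sum_r p r * expR (adv_sum r b).
Definition mgf_deriv j b : R := \sum_r p r * adv_ind r j * expR (adv_sum r b).
Definition mean j : R := \sum_r p r * adv_ind r j.

(** Grouping the rankings by the set of adversaries above [m] identifies [polyP] at exponentials
    with the moment generating function of the indicator vector of that set. *)
Lemma cgfKE b : cgfK p b = ln (mgf b).
Proof.
rewrite /cgfK /Defs.polyP /pX; congr ln.
under eq_bigr do rewrite mulr_suml.
rewrite /mgf (partition_big (@advs_above k) predT)//=.
apply: eq_bigr => A _; apply: eq_bigr => r /eqP <-; congr (_ * _).
rewrite -expR_sum; congr expR; rewrite /adv_sum [LHS]big_mkcond /=.
by apply: eq_bigr => j _; rewrite /adv_ind; case: ifP; rewrite ?mul1r ?mul0r.
Qed.

Lemma mgf_gt0 b : 0 < mgf b.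
Proof.
rewrite /mgf (bigD1 1%g)//= ltr_pwDl//; first by rewrite mulr_gt0 ?expR_gt0.
by apply: sumr_ge0 => r _; rewrite mulr_ge0 ?expR_ge0// ltW.
Qed.

Lemma adv_sum_line r b i (h : R) :
  adv_sum r (b + h *: delta_mx 0 i) = adv_sum r b + adv_ind r i * h.
Proof.
rewrite /adv_sum.
under eq_bigr do rewrite !mxE eqxx /= mulrDr.
rewrite big_split /=; congr (_ + _).
rewrite (bigD1 i)//= eqxx mulr1 big1 ?addr0// => j /negbTE ->.
by rewrite !mulr0.
Qed.

Lemma is_derive_exp_line (q a c x : R) :
  is_derive x (1 : R) (fun h : R => q * expR (a + c * h)) (q * c * expR (a + c * x)).
Proof.
by apply: is_derive_eq; rewrite /GRing.scale /=; ring.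
Qed.

Lemma is_derive_mgf b i (x : R) :
  is_derive x (1 : R) (fun h : R => mgf (b + h *: delta_mx 0 i))
    (mgf_deriv i (b + x *: delta_mx 0 i)).
Proof.
rewrite (_ : (fun h : R => mgf _) =
  (fun h : R => \sum_r p r * expR (adv_sum r b + adv_ind r i * h))); last first.
  by apply/funext => h; apply: eq_bigr => r _; rewrite adv_sum_line.
apply: (is_derive_eq (is_derive_bigsum _ (fun r => is_derive_exp_line _ _ _ _))).
by apply: eq_bigr => r _; rewrite adv_sum_line.
Qed.

Lemma is_derive_mgf_deriv b i j :
  is_derive (0 : R) (1 : R) (fun h : R => mgf_deriv j (b + h *: delta_mx 0 i))
    (\sum_r p r * adv_ind r j * adv_ind r i * expR (adv_sum r b)).
Proof.
rewrite (_ : (fun h : R => mgf_deriv _ _) =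
  (fun h : R => \sum_r p r * adv_ind r j * expR (adv_sum r b + adv_ind r i * h))); last first.
  by apply/funext => h; apply: eq_bigr => r _; rewrite adv_sum_line.
apply: (is_derive_eq (is_derive_bigsum _ (fun r => is_derive_exp_line _ _ _ _))).
by apply: eq_bigr => r _; rewrite mulr0 addr0.
Qed.

Lemma is_derive_cgfK b i (x : R) :
  is_derive x (1 : R) (fun h : R => cgfK p (b + h *: delta_mx 0 i))
    (mgf_deriv i (b + x *: delta_mx 0 i) / mgf (b + x *: delta_mx 0 i)).
Proof.
rewrite (_ : (fun h : R => cgfK p _) = @ln R \o (fun h : R => mgf (b + h *: delta_mx 0 i))).
  rewrite mulrC; apply: is_derive1_comp; last exact: is_derive_mgf.
  by apply: is_derive1_ln; exact: mgf_gt0.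
by apply/funext => h; rewrite /= cgfKE.
Qed.

Lemma derive_cgfK b j : derive (cgfK p) b (delta_mx 0 j) = mgf_deriv j b / mgf b.
Proof.
apply: derive_line; apply: is_derive_eq; first exact: is_derive_cgfK.
by rewrite scale0r addr0.
Qed.

Lemma adv_sum0 r : adv_sum r 0 = 0.
Proof. by rewrite /adv_sum big1// => j _; rewrite mxE mulr0. Qed.

Lemma mgf0 : mgf 0 = 1.
Proof. by rewrite /mgf -p_sum; apply: eq_bigr => r _; rewrite adv_sum0 expR0 mulr1. Qed.

Lemma mgf_deriv0 j : mgf_deriv j 0 = mean j.
Proof. by apply: eq_bigr => r _; rewrite adv_sum0 expR0 mulr1. Qed.

(** Differentiating the quotient [mgf_deriv j / mgf] at 0, where [mgf] is 1, gives the mixed second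
    moment minus the product of the means. *)
Lemma hessian_cgfK0 i j : hessian (cgfK p) 0 i j =
  \sum_r p r * ((adv_ind r i - mean i) * (adv_ind r j - mean j)).
Proof.
rewrite /hessian mxE.
rewrite (_ : (fun b => _) = (fun b => mgf_deriv j b / mgf b)); last first.
  by apply/funext => b; rewrite derive_cgfK.
transitivity (\sum_r p r * adv_ind r j * adv_ind r i - mean i * mean j); last first.
  under [RHS]eq_bigr => r _.
    rewrite (_ : _ * _ = p r * adv_ind r j * adv_ind r i - mean j * (p r * adv_ind r i)
       - mean i * (p r * adv_ind r j) + p r * (mean i * mean j)); last by ring.
    over.
  rewrite big_split/= !sumrB -!mulr_sumr -mulr_suml p_sum -!/(mean _); ring.
apply: derive_line.
have nz : mgf (0 + 0 *: delta_mx 0 i) != 0 by rewrite gt_eqF// mgf_gt0.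
rewrite (_ : (fun h : R => _) = (fun h : R => mgf_deriv j (0 + h *: delta_mx 0 i)) *
   (fun h : R => (mgf (0 + h *: delta_mx 0 i))^-1)); last by [].
have dV := is_deriveV nz (is_derive_mgf 0 i 0).
apply: is_derive_eq; first exact: (is_deriveM (is_derive_mgf_deriv 0 i j) dV).
rewrite /= scale0r addr0 mgf0 !mgf_deriv0 expr1n invr1 scale1r.
under eq_bigr do rewrite adv_sum0 expR0 mulr1.
rewrite /GRing.scale /=; ring.
Qed.

Lemma ranking_top : exists r : ranking k, forall j, adv_ind r j = 0.
Proof.
exists (tperm ord_max ord0) => j; rewrite /adv_ind inE /above tpermL.
by rewrite ltn0.
Qed.

(** Adversary [j] is first and [m] second. Together with [ranking_top], the indicator vector attains
    0 and every basis vector. *)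
Lemma ranking_second j : exists r : ranking k, forall i, adv_ind r i = (i == j)%:R.
Proof.
have k0 : (0 < k)%N by case: (k) j => [[]|].
have one : (1 < k.+1)%N by rewrite ltnS.
pose o1 : 'I_k.+1 := Ordinal one.
have aj i : adv i != ord_max by rewrite eq_sym neq_lift.
have m0 : (ord_max : 'I_k.+1) != ord0 by rewrite -val_eqE /= -lt0n.
pose r : ranking k := (tperm (adv j) ord0 * tperm ord_max o1)%g.
have rj : r (adv j) = ord0.
  by rewrite permM tpermL tpermD// -val_eqE.
have rm : r ord_max = o1.
  by rewrite permM [tperm (adv j) _ _]tpermD ?tpermL// eq_sym.
exists r => i; rewrite /adv_ind inE /above rm /=.
have [->|ij] := eqVneq i j; first by rewrite rj.
rewrite ltnS leqn0; congr (nat_of_bool _)%:R; apply/negbTE.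
apply/negP => /eqP ri0; have : r (adv i) = r (adv j) by apply/val_inj; rewrite rj.
by move/perm_inj/lift_inj => e; rewrite e eqxx in ij.
Qed.

(** The form at [u] is the variance of [adv_sum r u]. If it vanishes, positivity of [p] makes this
    sum the same for all rankings; comparing [ranking_top] with [ranking_second j] gives
    [u_j = 0]. *)
Lemma posdef_hessian : posdef (hessian (cgfK p) 0).
Proof.
have HE u : (u *m hessian (cgfK p) 0 *m u^T) ord0 ord0 =
    \sum_r p r * (adv_sum r u - \sum_j mean j * u ord0 j) ^+ 2.
  rewrite mxE; under eq_bigr => j _.
    rewrite !mxE mulr_suml.
    under eq_bigr => i _ do rewrite hessian_cgfK0 mulr_sumr mulr_suml.
    over.
  rewrite exchange_big /=; under eq_bigr do rewrite exchange_big /=.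
  rewrite exchange_big /=; apply: eq_bigr => r _.
  rewrite /adv_sum -sumrB expr2 mulr_suml mulr_sumr; apply: eq_bigr => i _.
  rewrite mulr_sumr mulr_sumr; apply: eq_bigr => j _; ring.
split.
  by apply/matrixP => i j; rewrite mxE !hessian_cgfK0; apply: eq_bigr => r _; ring.
move=> u u0; rewrite HE lt_neqAle; apply/andP; split; last first.
  by apply: sumr_ge0 => r _; rewrite mulr_ge0 ?sqr_ge0// ltW.
apply/negP => /eqP/esym/eqP; rewrite psumr_eq0; last first.
  by move=> r _; rewrite mulr_ge0 ?sqr_ge0// ltW.
move=> /allP all0.
have pr r : adv_sum r u = \sum_j mean j * u ord0 j.
  have := all0 r (mem_index_enum r); rewrite mulf_eq0 gt_eqF//= sqrf_eq0 subr_eq0.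
  by move/eqP.
case/eqP: u0; apply/rowP => j; rewrite mxE.
have [r0 hr0] := ranking_top; have [r1 hr1] := ranking_second j.
have e0 : adv_sum r0 u = 0 by rewrite /adv_sum big1// => i _; rewrite hr0 mul0r.
have e1 : adv_sum r1 u = u ord0 j.
  rewrite /adv_sum (bigD1 j)//= hr1 eqxx mul1r big1 ?addr0// => i /negbTE ij.
  by rewrite hr1 ij mul0r.
by rewrite -e1 pr -(pr r0) e0.
Qed.

(** Stationarity along each coordinate axis: the derivative of [cgfK] at 0 in direction [j] is
    [mean j]. *)
Lemma mean_crit (alpha : 'I_k -> R) :
  (forall t : 'rV[R]_k,
      - cgfK p t + \sum_(j < k) (1 - alpha j) * t ord0 j
      <= - cgfK p 0 + \sum_(j < k) (1 - alpha j) * (0 : 'rV[R]_k) ord0 j) ->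
  forall j, mean j = 1 - alpha j.
Proof.
move=> tmax j.
pose f (h : R) := - cgfK p (0 + h *: delta_mx 0 j) + (1 - alpha j) * h.
have df (x : R) : is_derive x (1 : R) f
   (- (mgf_deriv j (0 + x *: delta_mx 0 j) / mgf (0 + x *: delta_mx 0 j)) + (1 - alpha j)).
  rewrite (_ : f = (\- (fun h : R => cgfK p (0 + h *: delta_mx 0 j))) \+ ((1 - alpha j) \*: id)).
    apply: is_derive_eq; first apply: is_deriveD.
      by apply: is_deriveN; exact: is_derive_cgfK.
    by rewrite [_ *: 1]mulr1.
  by apply/funext => h.
have fE h : f h = - cgfK p (h *: delta_mx 0 j) +
    \sum_(i < k) (1 - alpha i) * (h *: delta_mx 0 j : 'rV[R]_k) ord0 i.
  rewrite /f add0r; congr (_ + _); rewrite (bigD1 j)//= !mxE !eqxx mulr1.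
  by rewrite big1 ?addr0// => i /negbTE ij; rewrite !mxE ij !mulr0.
have d0 : is_derive (0 : R) (1 : R) f 0.
  apply: (@derive1_at_max R f (-1) 1).
  - by lra.
  - by move=> x _; case: (df x).
  - by rewrite in_itv/= ltr01 ltrN10.
  - by move=> h _; rewrite !fE scale0r; exact: tmax.
have e1 : 'D_1 f 0 = 0 by case: d0.
case: (df 0) => _; rewrite e1 scale0r addr0 mgf0 mgf_deriv0 divr1 => h0.
by apply/eqP; rewrite -subr_eq0 -oppr_eq0 opprB addrC -h0.
Qed.

End Cumulants.

(** * Squeezing the winning probability *)

Section Iteration.
Variables (R : realType) (k : nat) (T : finType) (p : T -> R) (X : T -> 'rV[R]_k).

(** The outermost average is the choice of the first voter, so the induction splits a profile into
    head and tail, with [cons] and [uncons] as the bijection. *)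
Lemma iter_avg_opE n a (f : 'rV[R]_k -> R) x :
  iter n (avg_op p X a) f x =
  \sum_(s : {ffun 'I_n -> T}) \prod_i p (s i) * f (x + a *: \sum_i X (s i)).
Proof.
elim: n x => [|n ih] x.
  rewrite (big_pred1 [ffun i : 'I_0 => match notF (ltn_ord i) with end]).
    by rewrite !big_ord0 mul1r scaler0 addr0.
  move=> s; apply/esym/eqP; apply/ffunP; by case.
rewrite iterS {1}/avg_op.
under eq_bigr do rewrite ih mulr_sumr.
rewrite pair_big /=.
pose cons (q : T * {ffun 'I_n -> T}) : {ffun 'I_n.+1 -> T} :=
  [ffun i => if unlift ord0 i is Some j then q.2 j else q.1].
pose uncons (s : {ffun 'I_n.+1 -> T}) : T * {ffun 'I_n -> T} :=
  (s ord0, [ffun j => s (lift ord0 j)]).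
rewrite [RHS](reindex cons) /=; last first.
  exists uncons => [[t s] _|s _].
    rewrite /uncons /cons; congr (_, _); first by rewrite ffunE unlift_none.
    by apply/ffunP => j; rewrite !ffunE liftK.
  apply/ffunP => i; rewrite ffunE /uncons /=.
  by case: unliftP => [j ->|->] //=; rewrite ffunE.
apply: eq_bigr => -[t s] _ /=; rewrite !big_ord_recl.
have c0 : cons (t, s) ord0 = t by rewrite ffunE unlift_none.
have cS j : cons (t, s) (lift ord0 j) = s j by rewrite ffunE liftK.
have -> : \prod_(i < n) p (cons (t, s) (lift ord0 i)) = \prod_i p (s i).
  by apply: eq_bigr => j _; rewrite cS.
have -> : \sum_(i < n) X (cons (t, s) (lift ord0 i)) = \sum_i X (s i).
  by apply: eq_bigr => j _; rewrite cS.
by rewrite c0 scalerDr addrA mulrA.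
Qed.

End Iteration.

Section TestFunctions.
Variables (R : realType) (k : nat).
Implicit Types (x u : 'rV[R]_k) (N : nat).

Definition ftest N x : R := \prod_j step (N.+1%:R * x ord0 j).

Lemma ftest_bounds N x : 0 <= ftest N x <= 1.
Proof.
have b (y : R) : 0 <= step y <= 1 by have [] := step_bounds y.
apply: (big_ind (fun y : R => 0 <= y <= 1)) => [|y z /andP[y0 y1] /andP[z0 z1]|j _].
- by rewrite ler01 lexx.
- by rewrite mulr_ge0// mulr_ile1.
- exact: b.
Qed.

Lemma ftest_smooth N : exists C D B, @tsmooth R k C (ftest N) D B.
Proof.
by apply: tsmooth_prod => j; apply: tsmooth_step; rewrite ler1n.
Qed.

Lemma ftest_ge3 N x : (forall j, 3 <= N.+1%:R * x ord0 j) -> ftest N x = 1.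
Proof. by move=> x3; apply: big1 => j _; exact: step_ge3. Qed.

Lemma ftest_le0 N x j : N.+1%:R * x ord0 j <= 0 -> ftest N x = 0.
Proof. by move=> x0; rewrite /ftest (bigD1 j)//= step_le0// mul0r. Qed.

Lemma gauss_ops_shift a ws (h : 'rV[R]_k -> R) u x :
  gauss_ops a ws (fun x => h (x + u)) x = gauss_ops a ws h (x + u).
Proof.
elim: ws x => [//|q ws ih] x /=; rewrite /gauss_op; congr gaussE; apply/funext => z.
by rewrite ih addrAC.
Qed.

(** After the factor [N.+1] this is a shift by 3, the width of the ramp of [step], so the shifted
    test function equals 1 on the whole orthant. *)
Definition shift3 N : 'rV[R]_k := const_mx (3 / N.+1%:R).

Lemma ftest_cvg (d : nat -> 'rV[R]_k) u :
  (forall N j, 0 <= N.+1%:R * d N ord0 j <= 3) -> (forall j, u ord0 j != 0) ->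
  ftest N (u + d N) @[N --> \oo] --> (1 : R) * [forall j, 0 < u ord0 j]%:R.
Proof.
move=> db u0; rewrite mul1r.
(* Past [K] every scaled coordinate has modulus at least 3, and a shift within [0, 3] cannot bring
   it back onto the ramp. The sum serves as a common bound for all coordinates. *)
pose K := (\sum_(j < k) Num.truncn (3 / `|u ord0 j|))%N.
have big N j : (K <= N)%N -> 3 <= N.+1%:R * `|u ord0 j|.
  move=> KN; rewrite -ler_pdivrMr ?normr_gt0//.
  apply: ltW; apply: (lt_le_trans (truncnS_gt _)).
  by rewrite ler_nat ltnS (leq_trans _ KN)// /K (bigD1 j)//= leq_addr.
apply: cvg_near_cst; near=> N.
have KN : (K <= N)%N by near: N; exact: nbhs_infty_ge.
case: forallP => [up|/forallP/forallPn[j]] /=.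
  rewrite ftest_ge3// => j; rewrite mxE mulrDr.
  have := big N j KN; rewrite gtr0_norm//; have /andP[] := db N j; lra.
rewrite -leNgt le_eqVlt (negbTE (u0 j)) /= => uj.
apply: (ftest_le0 (j := j)); rewrite mxE mulrDr.
have := big N j KN; rewrite ltr0_norm//; have /andP[] := db N j; lra.
Unshelve. all: by end_near. Qed.

End TestFunctions.

(** [N] is fixed before [n] grows, so the rates in [n] may depend on [N]. The bounds on [A] force
    the extended real [l] to be finite. *)
Lemma squeeze_family (R : realType) (P : nat -> R) (lo up : nat -> nat -> R)
    (A B : nat -> R) (l : \bar R) :
  (forall N n, lo N n <= P n <= up N n) ->
  (forall N, lo N n @[n --> \oo] --> A N) -> (forall N, up N n @[n --> \oo] --> B N) ->
  (forall N, 0 <= A N <= 1) ->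
  (A N)%:E @[N --> \oo] --> l -> (B N)%:E @[N --> \oo] --> l ->
  (P n)%:E @[n --> \oo] --> l.
Proof.
move=> loup loA upB A01 Al Bl.
have l0 : (0 <= l)%E.
  rewrite -(cvg_lim _ Al)//; apply: lime_ge; first by apply/cvg_ex; exists l.
  by apply: nearW => N; rewrite lee_fin; case/andP: (A01 N).
have l1 : (l <= 1)%E.
  rewrite -(cvg_lim _ Al)//; apply: lime_le; first by apply/cvg_ex; exists l.
  by apply: nearW => N; rewrite lee_fin; case/andP: (A01 N).
have lfin : l \is a fin_num.
  by rewrite ge0_fin_numE// (le_lt_trans l1)// ltry.
rewrite -(fineK lfin) in Al Bl *; set r := fine l in Al Bl *.
have {}Al : A N @[N --> \oo] --> r by move/fine_cvgP : Al => [].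
have {}Bl : B N @[N --> \oo] --> r by move/fine_cvgP : Bl => [].
apply: cvg_EFin; first exact: nearW.
apply/cvgrPdist_le => /= e e0.
have e2 : 0 < e / 2 by rewrite divr_gt0.
have [N [AN BN]] : exists N, `|r - A N| <= e / 2 /\ `|r - B N| <= e / 2.
  move/cvgrPdist_le : Al => /(_ _ e2) hA; move/cvgrPdist_le : Bl => /(_ _ e2) hB.
  by have [N [hAN hBN]] := filter_ex (filterI hA hB); exists N.
near=> n.
have hlo : `|A N - lo N n| <= e / 2.
  by near: n; move/cvgrPdist_le : (loA N) => /(_ _ e2).
have hup : `|B N - up N n| <= e / 2.
  by near: n; move/cvgrPdist_le : (upB N) => /(_ _ e2).
move: AN BN hlo hup; rewrite !ler_norml => /andP[? ?] /andP[? ?] /andP[? ?] /andP[? ?].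
have /andP[? ?] := loup N n.
by apply/andP; split; lra.
Unshelve. all: by end_near. Qed.

Section Voting.
Variables (R : realType) (k : nat) (p : ranking k -> R).
Hypothesis p_pos : forall r, 0 < p r.
Hypothesis p_sum : \sum_(r : ranking k) p r = 1.
Variable alpha : 'I_k -> R.

Definition score (r : ranking k) : 'rV[R]_k :=
  \row_j ((above r ord_max (adv j))%:R - alpha j).

Lemma aboveC (r : ranking k) j : (above r ord_max (adv j))%:R = 1 - adv_ind R r j.
Proof.
rewrite /adv_ind inE /above; case: ltngtP => [_|_|e]; rewrite ?subr0 ?subrr//.
have /perm_inj/eqP : r ord_max = r (adv j) by apply/val_inj.
by rewrite /adv (negbTE (neq_lift _ _)).
Qed.

Lemma alpha_winnerE n (s : {ffun 'I_n -> ranking k}) :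
  alpha_winner alpha s = [forall j, 0 < (\sum_i score (s i)) ord0 j].
Proof.
rewrite /alpha_winner; apply: eq_forallb => j; rewrite summxE.
under [in RHS]eq_bigr do rewrite mxE.
rewrite sumrB sumr_const card_ord subr_gt0 mulr_natr; congr (_ < _).
rewrite -sum1_card natr_sum big_mkcond /=.
apply: eq_bigr => i _; rewrite (_ : (i \in _) = above (s i) ord_max (adv j)).
  by case: ifP.
by apply/idP/idP => [/set_mem //|h]; exact/mem_set.
Qed.

Lemma prob_winner_bounds n a N : 0 < a ->
  iter n (avg_op p score a) (ftest N) 0 <= prob_winner p alpha n
    <= iter n (avg_op p score a) (ftest N) (shift3 R k N).
Proof.
move=> a0; rewrite /prob_winner big_mkcond /= !iter_avg_opE.
have pr0 (s : {ffun 'I_n -> ranking k}) : 0 <= \prod_i p (s i).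
  by apply: prodr_ge0 => i _; exact: ltW.
have [b0 b1] : (forall x : 'rV[R]_k, 0 <= ftest N x) /\ (forall x : 'rV[R]_k, ftest N x <= 1).
  by split=> x; have /andP[] := ftest_bounds N x.
have NE : N.+1%:R * (3 / N.+1%:R) = 3 :> R by rewrite mulrCA mulfV// mulr1.
apply/andP; split; apply: ler_sum => s _; rewrite alpha_winnerE.
- case: forallP => [_|/forallP/forallPn[j]]; first by rewrite -[leRHS]mulr1 ler_wpM2l.
  rewrite -leNgt => sj; rewrite (ftest_le0 (j := j)) ?mulr0//.
  by rewrite add0r mxE pmulr_rle0// pmulr_rle0.
- case: forallP => [sj|_]; last by rewrite mulr_ge0.
  rewrite ftest_ge3 ?mulr1// => j; rewrite !mxE mulrDr NE lerDl.
  by rewrite mulr_ge0// mulr_ge0// ltW.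
Qed.

End Voting.

Theorem theorem3 (R : realType) (k : nat) (hk : (0 < k)%N)
  (p : ranking k -> R) (p_pos : forall r, 0 < p r)
  (p_sum : \sum_(r : ranking k) p r = 1)
  (alpha : 'I_k -> R) (alpha_bd : forall j, 0 < alpha j < 1)
  (tau : 'rV[R]_k)
  (tau_max : forall t : 'rV[R]_k,
      - cgfK p t + \sum_(j < k) (1 - alpha j) * t ord0 j
      <= - cgfK p tau + \sum_(j < k) (1 - alpha j) * tau ord0 j)
  (zeta_crit : forall j : 'I_k, expR (tau ord0 j) = 1) :
  let H := hessian (cgfK p) tau in
  ((fun n => (prob_winner p alpha n)%:E) @ \oo -->
    ((Num.sqrt ((2 * pi) ^+ k * \det H))^-1%:E *
     orthant_integral
       (fun u : 'rV[R]_k => (expR (- ((u *m invmx H *m u^T) ord0 ord0) / 2))%:E))%E).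
Proof.
have tau0 : tau = 0.
  apply/rowP => j; rewrite mxE; apply: expR_inj; rewrite expR0.
  exact: zeta_crit.
subst tau => H.
have meanE := mean_crit p_pos p_sum tau_max.
have pH : posdef H := posdef_hessian p_pos p_sum.
have p_ge0 r : 0 <= p r by exact: ltW.
(* By stationarity the score is minus a centred indicator; the sign cancels in second moments, which
   are therefore the entries of the Hessian. *)
have scoreE r i : score alpha r ord0 i = mean p i - adv_ind R r i.
  by rewrite mxE aboveC meanE; ring.
have score_mean i : \sum_r p r * score alpha r ord0 i = 0.
  under eq_bigr do rewrite scoreE mulrBr.
  by rewrite sumrB -mulr_suml p_sum mul1r subrr.
have score_cov i j : \sum_r p r * (score alpha r ord0 i * score alpha r ord0 j) =
    \sum_(q <- chol H) q.1 ^+ 2 * (q.2 ord0 i * q.2 ord0 j).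
  rewrite chol_cov// hessian_cgfK0//; apply: eq_bigr => r _.
  by rewrite !scoreE; ring.
pose a n : R := (Num.sqrt n.+1%:R)^-1.
have a_gt0 n : 0 < a n by rewrite invr_gt0 sqrtr_gt0.
have clt N x : iter n.+1 (avg_op p (score alpha) (a n)) (ftest N) x @[n --> \oo] -->
    gauss_ops 1 (chol H) (ftest N) x.
  have [C [D [B tf]]] := ftest_smooth R k N.
  exact: (clt_smooth p_ge0 p_sum score_mean (chol_pos pH) score_cov tf).
have F01 N x := @ftest_bounds R k N x.
have Fbl N : exists C, bdlip 1 C (@ftest R k N).
  have [C [D [B tf]]] := ftest_smooth R k N; exists C.
  split=> [x|]; last by case: (ts_bdlip tf).
  by rewrite ger0_norm; case/andP: (F01 N x).
(* Stated for any shift within the ramp, so that the lower family ([d = 0]) and the upper one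
   ([shift3]) get the same limit. *)
have limit (d : nat -> 'rV[R]_k) : (forall N j, 0 <= N.+1%:R * d N ord0 j <= 3) ->
    (gauss_ops 1 (chol H) (ftest N) (d N))%:E @[N --> \oo] -->
    ((gauss_const H)%:E *
     orthant_integral (fun u : 'rV[R]_k => (expR (- qform H u / 2))%:E))%E.
  move=> db.
  rewrite (_ : (fun N => _) = (fun N =>
      (gauss_ops 1 (chol H) (fun x => ftest N (x + d N)) 0)%:E)); last first.
    by apply/funext => N; rewrite gauss_ops_shift add0r.
  rewrite (_ : (fun u => _) = (fun u : 'rV[R]_k =>
      (1 * expR (- qform H (u - 0) / 2))%:E)); last first.
    by apply/funext => u; rewrite mul1r subr0.
  apply: (gauss_ops_orthant (M := 1)) => //.
  - by move=> N; have [C bC] := Fbl N; exists C; exact: bdlip_shift.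
  - by move=> N u; case/andP: (F01 N (u + d N)).
  - by move=> u u0; exact: ftest_cvg.
(* The central limit statement concerns [n.+1] voters, which avoids dividing by [sqrt 0]. *)
rewrite -(cvg_shiftS (fun n => (prob_winner p alpha n)%:E)).
apply: (squeeze_family (fun N n => prob_winner_bounds p_pos alpha n.+1 N (a_gt0 n))
  (fun N => clt N 0) (fun N => clt N (shift3 R k N))).
- move=> N; have b0 x : 0 <= @ftest R k N x by case/andP: (F01 N x).
  have [C bC] := Fbl N.
  rewrite gauss_ops_ge0//= (le_trans (ler_norm _))//.
  by case: (gauss_ops_bdlip 1 (chol H) bC).
- by apply: (limit (fun=> 0)) => N j; rewrite mxE mulr0 lexx ler0n.
- apply: (limit (@shift3 R k)) => N j; rewrite mxE mulrCA mulfV// mulr1.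
  by rewrite ler0n lexx.
Qed.
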